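(* (Consistency) Let $T>0$ and let $s\ge1$ be an integer. Let $u(x,\tau)$ be the solution on $[0,2\pi]\times[0,T]$ of $$\frac{\partial u}{\partial\tau}=A\frac{\partial^2u}{\partial x^2}+B\frac{\partial u}{\partial x}+C\Big(\frac{\partial u}{\partial x}\Big)^2,\quad u(0,\tau)=u(2\pi,\tau),\ u_x(0,\tau)=u_x(2\pi,\tau),\quad u(x,0)=u_0(x).$$ Suppose that for all $\tau\in[0,T]$, $u(\tau)\in H^{s+2}_p$ and $u_\tau(\tau)\in H^s_p$ (with the maxima below finite). For $\tau\in[0,T]$ define $F^N(\tau)\in S_N$ by $$F^N(x_j,\tau)=\Big[\frac{\partial I_N(u)}{\partial\tau}-A\frac{\partial^2I_N(u)}{\partial x^2}-B\frac{\partial I_N(u)}{\partial x}-C\Big(\frac{\partial I_N(u)}{\partial x}\Big)^2\Big](x_j,\tau),\quad j=0,\dots,2N-1.$$ Then there exists a constant $$M=M\Big(\max_{0\le\tau\le T}\Big\{\Big\|\frac{\partial^{s+1}u}{\partial x^{s+1}}\Big\|,\Big\|\frac{\partial^{s+2}u}{\partial x^{s+2}}\Big\|,\Big\|\frac{\partial^su_\tau}{\partial x^s}\Big\|\Big\}\Big),$$ independent of $N$, such that $$\max_{0\le\tau\le T}\|F^N(\tau)\|\le MN^{-s}.$$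
   Context: For $N\in\mathbb N$ ($N\ge1$), $S_N=\mathrm{span}\{e^{ikx}:-N\le k\le N-1\}$, with nodes $x_j=j\pi/N$, $j=0,\dots,2N-1$. $I_N(u)\in S_N$ denotes the trigonometric interpolant of $u$ at these nodes: $I_N(u)=\sum_{k=-N}^{N-1}\hat u_ke^{ikx}$, $\hat u_k=\frac1{2N}\sum_{j=0}^{2N-1}u(x_j)e^{-ikx_j}$. $\|\cdot\|$ is the $L^2(0,2\pi)$ norm (complex-valued functions). $H^s_p=H^s_p(0,2\pi)$ is the space of $v\in L^2(0,2\pi)$ such that for $0\le k\le s$ the derivative $d^kv/dx^k$ in the sense of periodic distributions belongs to $L^2(0,2\pi)$. $u(\tau)$ denotes $u(\cdot,\tau)$. The constants are $A=C=\kappa^2\frac{\sigma^2}2>0$ and $B=\kappa\left(\alpha-\frac{\sigma^2}2\right)$, with $\kappa=\frac{2\pi}{4\hat x_{\max}-4\hat x_{\min}}$, where $\alpha\in\mathbb R$, $\sigma>0$ and $\hat x_{\min}<\hat x_{\max}$ are fixed reals. Constants may depend also on the fixed data $A,B,C,s$. It is a standing assumption that $u_0$ has the same regularity as required of $u$. *)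

(* Defs.v *)
From HB Require Import structures.
From mathcomp Require Import all_boot all_order all_algebra.
From mathcomp Require Import all_classical all_reals all_analysis.
From mathcomp Require Export complex.

Set Implicit Arguments.
Unset Strict Implicit.
Unset Printing Implicit Defensive.

Import Order.TTheory GRing.Theory Num.Theory.
Import numFieldNormedType.Exports.

Local Open Scope classical_set_scope.
Local Open Scope ring_scope.
Local Open Scope complex_scope.

Section calculus.
Variable R : realType.
Implicit Types (D : set R) (f g v w phi : R -> R[i]).

Definition RePart f : R -> R := fun x => complex.Re (f x).
Definition ImPart f : R -> R := fun x => complex.Im (f x).

(* Derivatives relative to a set D: the difference quotient at x is taken over
   points of D only, so that they are one-sided at the end points of a closed
   interval. Complex-valued functions are differentiated componentwise. *)
Definition quotient (f : R -> R) (x y : R) : R := (f y - f x) / (y - x).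

Definition derivable_in D f (x : R) : Prop :=
  cvg (quotient (RePart f) x @ within D x^') /\
  cvg (quotient (ImPart f) x @ within D x^').

Definition deriv_in D f (x : R) : R[i] :=
  lim (quotient (RePart f) x @ within D x^') +i*
  lim (quotient (ImPart f) x @ within D x^').

Definition dx f : R -> R[i] := deriv_in `[0, 2 * pi] f.

(* a function u of (tau, x) is written as u tau x *)
Definition dtau (T : R) (u : R -> R -> R[i]) : R -> R -> R[i] :=
  fun tau x => deriv_in `[0, T] (fun t => u t x) tau.

Definition cintegral f : R[i] :=
  (\int[lebesgue_measure]_(x in `]0%R, (2 * pi)%R[) RePart f x) +i*
  (\int[lebesgue_measure]_(x in `]0%R, (2 * pi)%R[) ImPart f x).

Definition L2norm f : \bar R :=
  Lnorm lebesgue_measure 2%:E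
    ((fun x => (Normc.normc (f x))%:E) \_ `]0, 2 * pi[).

Definition L2 : set (R -> R[i]) := [set f |
  [/\ measurable_fun `]0, 2 * pi[ (RePart f),
      measurable_fun `]0, 2 * pi[ (ImPart f) &
      (L2norm f < +oo)%E]].

Definition smooth_periodic phi : Prop :=
  (forall x, phi (x + 2 * pi) = phi x) /\
  (forall n x, derivable (derive1n n (RePart phi)) x 1 /\
               derivable (derive1n n (ImPart phi)) x 1).

Definition cderive1n n phi : R -> R[i] :=
  fun x => derive1n n (RePart phi) x +i* derive1n n (ImPart phi) x.

Definition is_pderiv (k : nat) v w : Prop :=
  forall phi, smooth_periodic phi ->
    cintegral (fun x => v x * cderive1n k phi x) =
    (-1) ^+ k * cintegral (fun x => w x * phi x).

Definition Hp (s : nat) : set (R -> R[i]) := [set v |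
  L2 v /\ forall k, (k <= s)%N -> exists2 w, L2 w & is_pderiv k v w].

(* the k-th periodic distributional derivative in L2, which is unique up to
   equality almost everywhere; it is 0 by convention if there is none *)
Definition pderiv (k : nat) v : R -> R[i] :=
  xget (fun=> 0) [set w | L2 w /\ is_pderiv k v w].

End calculus.

Section trigonometric_interpolation.
Variable R : realType.

Definition expi (k : int) (x : R) : R[i] := cos (k%:~R * x) +i* sin (k%:~R * x).

Definition node (N j : nat) : R := j%:R * pi / N%:R.

(* the index k < 2N stands for the frequency k - N, ranging over -N, ..., N-1 *)
Definition freq (N k : nat) : int := k%:Z - N%:Z.

Definition trig_sum (N : nat) (c : 'I_(2 * N) -> R[i]) : R -> R[i] :=
  fun x => \sum_(k < 2 * N) c k * expi (freq N k) x.

Definition S_ (N : nat) : set (R -> R[i]) := range (@trig_sum N).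

Definition dft (N : nat) (u : R -> R[i]) (k : int) : R[i] :=
  (2 * N)%:R^-1 * \sum_(j < 2 * N) u (node N j) * expi (- k) (node N j).

Definition interp (N : nat) (u : R -> R[i]) : R -> R[i] :=
  trig_sum (fun k : 'I_(2 * N) => dft N u (freq N k)).

End trigonometric_interpolation.

Section problem.
Variable R : realType.
Implicit Types (alpha sigma xmin xmax A B C T : R) (u : R -> R -> R[i]).

Definition kappa xmin xmax : R := 2 * pi / (4 * xmax - 4 * xmin).

Definition diffusion sigma xmin xmax : R :=
  kappa xmin xmax ^+ 2 * (sigma ^+ 2 / 2).

Definition advection alpha sigma xmin xmax : R :=
  kappa xmin xmax * (alpha - sigma ^+ 2 / 2).

Definition residual A B C T u : R -> R -> R[i] := fun tau x =>
  dtau T u tau x - A%:C * dx (dx (u tau)) x - B%:C * dx (u tau) x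
    - C%:C * dx (u tau) x ^+ 2.

Record is_solution A B C T (u0 : R -> R[i]) u : Prop := IsSolution {
  sol_dtau : forall tau x, tau \in `[0, T] -> x \in `[0, 2 * pi] ->
    derivable_in `[0, T] (fun t => u t x) tau ;
  sol_dx : forall tau x, tau \in `[0, T] -> x \in `[0, 2 * pi] ->
    derivable_in `[0, 2 * pi] (u tau) x ;
  sol_dxx : forall tau x, tau \in `[0, T] -> x \in `[0, 2 * pi] ->
    derivable_in `[0, 2 * pi] (dx (u tau)) x ;
  sol_pde : forall tau x, tau \in `[0, T] -> x \in `[0, 2 * pi] ->
    dtau T u tau x =
    A%:C * dx (dx (u tau)) x + B%:C * dx (u tau) x + C%:C * dx (u tau) x ^+ 2 ;
  sol_per : forall tau, tau \in `[0, T] -> u tau 0 = u tau (2 * pi) ;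
  sol_dx_per : forall tau, tau \in `[0, T] -> dx (u tau) 0 = dx (u tau) (2 * pi) ;
  sol_init : forall x, x \in `[0, 2 * pi] -> u 0 x = u0 x }.

(* max over [0, T] of the three norms; the maxima over tau are suprema in \bar R *)
Definition regularity_max (s : nat) T u : \bar R :=
  ereal_sup [set maxe (L2norm (pderiv s.+1 (u tau)))
                (maxe (L2norm (pderiv s.+2 (u tau)))
                      (L2norm (pderiv s (dtau T u tau)))) | tau in `[0, T] ].

(* F^N for the semi-discrete problem: F tau is the element of S_N that takes at
   the nodes the values of the residual of I_N(u) *)
Definition is_consistency_error A B C T (N : nat) u (F : R -> R -> R[i]) : Prop :=
  forall tau, tau \in `[0, T] ->
    S_ N (F tau) /\
    forall j : 'I_(2 * N), F tau (node R N j) =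
      residual A B C T (fun t => interp N (u t)) tau (node R N j).

End problem.

(* Main.v *)
(** Fix a time and let [c] be the Fourier coefficients of [v := u tau].  Since
    [v] is differentiable and periodic its Fourier series converges to it at every
    point; Bessel's inequality for the derivative of order [s + 2] makes
    [sum (|n|^(s+2) |c n|)^2] finite, so the series can be differentiated termwise
    twice.  At the nodes the frequencies [k] and [k + 2 N l] coincide, hence [v] and
    its interpolant differ there by the aliased frequencies only, that is, those
    with [l <> 0], all of modulus at least [N].  Cauchy-Schwarz and the decay of
    [c] bound the discrete L2 norm of the resulting error of the first two
    derivatives by a multiple of [N^-s].  Inserting the equation satisfied by [u],
    the residual is a combination of these errors, the quadratic term being
    factored as a difference of squares, and on [S_ N] the L2 norm is the discrete
    one. *)
Require Import Defs.
From HB Require Import structures.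
From mathcomp Require Import all_boot all_order all_algebra.
From mathcomp Require Import all_classical all_reals all_analysis.
From mathcomp Require Import measurable_realfun ring lra zify.
Set Implicit Arguments.
Unset Strict Implicit.
Unset Printing Implicit Defensive.
Import Order.TTheory GRing.Theory Num.Theory.
Import numFieldNormedType.Exports.
Local Open Scope classical_set_scope.
Local Open Scope ring_scope.
Local Open Scope complex_scope.

Local Notation normc := Normc.normc.
Local Notation Re := complex.Re.
Local Notation Im := complex.Im.

(** * Complex numbers, exponentials and symmetric sums *)

(** The regularity of [u tau] is distributional, while the derivatives in the equation are pointwise
    limits, one-sided at the end points. Fourier series are the bridge between the two. The aliasing
    estimates are made on finite windows -N(2L+1) <= n < N(2L+1), each the union of 2L+1 translates
    of the frequency range of [S_ N]. They are uniform in L, and only the finished bound passes to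
    the limit, so no infinite series is ever rearranged. Time contributes no error: the interpolant
    agrees with u at the nodes at every time, hence so do the time derivatives there, and the
    equation can be inserted node by node. Origin of the constant: if r bounds the derivative of
    order s + 2, Bessel gives S0 = r^2 / (2 pi) for the weighted sum of squares. Then sum |n|^2 |c
    n| <= (S0 + 6) / 2, where 6 bounds the sum of n^-2; the factor a + b of a^2 - b^2 consists of
    two terms of this size, whence S0 + 6. Finally 96 = 3 * 2 * 16: three terms of the residual, 2N
    nodes, and 16 from the aliased tail. *)

Section complex_norm.
Variable R : realType.
Implicit Types z w : R[i].

Lemma cReD z w : Re (z + w) = Re z + Re w. Proof. by case: z; case: w. Qed.
Lemma cImD z w : Im (z + w) = Im z + Im w. Proof. by case: z; case: w. Qed.
Lemma cReN z : Re (- z) = - Re z. Proof. by case: z. Qed.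
Lemma cImN z : Im (- z) = - Im z. Proof. by case: z. Qed.
Lemma cReM z w : Re (z * w) = Re z * Re w - Im z * Im w.
Proof. by case: z; case: w. Qed.
Lemma cImM z w : Im (z * w) = Re z * Im w + Im z * Re w.
Proof. by case: z => a b; case: w => c d /=. Qed.

Lemma complexP z w : Re z = Re w -> Im z = Im w -> z = w.
Proof. by case: z => a b; case: w => c d /= -> ->. Qed.

Lemma normc_ge0 z : 0 <= normc z.
Proof. by case: z => a b; exact: sqrtr_ge0. Qed.

Lemma sqr_normc2 z : normc z ^+ 2 = Re z ^+ 2 + Im z ^+ 2.
Proof. by case: z => a b; rewrite /= sqr_sqrtr ?addr_ge0 ?sqr_ge0. Qed.

Lemma sqr_normcJ z : (normc z ^+ 2)%:C = z * conjc z.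
Proof. by apply: complexP; rewrite sqr_normc2; case: z => a b /=; ring. Qed.

Lemma conjM z w : conjc (z * w) = conjc z * conjc w.
Proof. exact: rmorphM. Qed.

Lemma normc_conj z : normc (conjc z) = normc z.
Proof. by case: z => a b /=; rewrite sqrrN. Qed.

Lemma normc_real (a : R) : normc (a%:C) = `|a|.
Proof. by rewrite /= expr0n addr0 sqrtr_sqr. Qed.

Lemma normc_Re z : `|Re z| <= normc z.
Proof.
rewrite -(ler_pXn2r (n:=2)) ?nnegrE ?normr_ge0 ?normc_ge0//.
by rewrite sqr_normc2 real_normK ?num_real// lerDl sqr_ge0.
Qed.

Lemma normc_Im z : `|Im z| <= normc z.
Proof.
rewrite -(ler_pXn2r (n:=2)) ?nnegrE ?normr_ge0 ?normc_ge0//.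
by rewrite sqr_normc2 real_normK ?num_real// lerDr sqr_ge0.
Qed.

Lemma normc_le_Re_Im z : normc z <= `|Re z| + `|Im z|.
Proof.
rewrite -(ler_pXn2r (n:=2)) ?nnegrE ?addr_ge0 ?normc_ge0//.
rewrite sqr_normc2 sqrrD !real_normK ?num_real//.
by rewrite [leRHS]addrAC lerDl mulrn_wge0// mulr_ge0.
Qed.

Lemma normcX z n : normc (z ^+ n) = normc z ^+ n.
Proof.
by elim: n => [|n IH]; rewrite ?expr0 ?Normc.normc1// !exprS Normc.normcM IH.
Qed.

Lemma normc_int (n : int) : normc (n%:~R : R[i]) = `|n%:~R : R|.
Proof.
have -> : (n%:~R : R[i]) = (n%:~R : R)%:C by rewrite rmorph_int.
exact: normc_real.
Qed.

Lemma normci : normc ('i : R[i]) = 1.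
Proof. by rewrite /= expr0n expr1n add0r sqrtr1. Qed.

Lemma normc_sum I (r : seq I) (P : pred I) (F : I -> R[i]) :
  normc (\sum_(i <- r | P i) F i) <= \sum_(i <- r | P i) normc (F i).
Proof.
apply: (big_ind2 (fun z a => normc z <= a)) => //; first by rewrite Normc.normc0.
by move=> z a w b za wb; apply: le_trans (le_normcD _ _) (lerD za wb).
Qed.

Lemma sqr_normcD3 z1 z2 z3 : normc (z1 + z2 + z3) ^+ 2 <=
  3 * (normc z1 ^+ 2 + normc z2 ^+ 2 + normc z3 ^+ 2).
Proof.
have h := le_trans (le_normcD _ z3) (lerD (le_normcD z1 z2) (lexx (normc z3))).
have -> : 3 * (normc z1 ^+ 2 + normc z2 ^+ 2 + normc z3 ^+ 2) =
  (normc z1 + normc z2 + normc z3) ^+ 2 + (normc z1 - normc z2) ^+ 2 +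
  (normc z1 - normc z3) ^+ 2 + (normc z2 - normc z3) ^+ 2 by ring.
apply: (@le_trans _ _ ((normc z1 + normc z2 + normc z3) ^+ 2)); last first.
  by do 2![apply: ler_wpDr; first exact: sqr_ge0]; rewrite lerDl sqr_ge0.
by rewrite ler_pXn2r ?nnegrE ?addr_ge0 ?normc_ge0.
Qed.

End complex_norm.

Section cauchy_schwarz.
Variable R : realType.

Lemma sum_cauchy_schwarz I (r : seq I) (f g : I -> R) :
  (\sum_(i <- r) f i * g i) ^+ 2 <=
  (\sum_(i <- r) f i ^+ 2) * (\sum_(i <- r) g i ^+ 2).
Proof.
elim: r => [|i r IH]; first by rewrite !big_nil expr0n mulr0.
rewrite !big_cons; set S := \sum_(_ <- _) _ in IH *.
set X := \sum_(j <- r) f j ^+ 2 in IH *; set Y := \sum_(j <- r) g j ^+ 2 in IH *.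
have X0 : 0 <= X by apply: sumr_ge0 => j _; exact: sqr_ge0.
have Y0 : 0 <= Y by apply: sumr_ge0 => j _; exact: sqr_ge0.
(* The new cross term: S^2 <= X Y by induction, so 2 |S f g| <= 2 sqrt(X Y) |f g| <= X g^2 + Y f^2;
   squaring both sides avoids the root. *)
suff : 2 * (S * (f i * g i)) <= X * g i ^+ 2 + Y * f i ^+ 2.
  move=> h; rewrite -subr_ge0.
  have -> : (f i ^+ 2 + X) * (g i ^+ 2 + Y) - (f i * g i + S) ^+ 2 =
    (X * Y - S ^+ 2) + (X * g i ^+ 2 + Y * f i ^+ 2 - 2 * (S * (f i * g i))) by ring.
  by rewrite addr_ge0 ?subr_ge0.
have XY0 : 0 <= X * g i ^+ 2 + Y * f i ^+ 2 by rewrite addr_ge0// mulr_ge0// sqr_ge0.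
apply: le_trans (ler_norm _) _.
rewrite -(ler_pXn2r (n:=2)) ?nnegrE ?normr_ge0// real_normK ?num_real//.
rewrite !exprMn.
apply: (@le_trans _ _ (4 * (X * Y * (f i ^+ 2 * g i ^+ 2)))).
  rewrite (_ : 2 ^+ 2 = 4 :> R); last by ring.
  by rewrite ler_pM2l// ler_wpM2r// mulr_ge0// sqr_ge0.
rewrite -subr_ge0.
have -> : (X * g i ^+ 2 + Y * f i ^+ 2) ^+ 2 - 4 * (X * Y * (f i ^+ 2 * g i ^+ 2)) =
  (X * g i ^+ 2 - Y * f i ^+ 2) ^+ 2 by ring.
exact: sqr_ge0.
Qed.

End cauchy_schwarz.

Section exponentials.
Variable R : realType.
Implicit Types (m n : int) (x y : R).

Lemma expi0 x : expi 0 x = 1.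
Proof. by rewrite /expi mul0r cos0 sin0. Qed.

Lemma expi_at0 n : expi n 0 = 1 :> R[i].
Proof. by rewrite /expi mulr0 cos0 sin0. Qed.

Lemma expiD m n x : expi (m + n) x = expi m x * expi n x.
Proof.
apply: complexP; rewrite /expi /= intrD mulrDl.
  by rewrite cosD.
by rewrite sinD; ring.
Qed.

Lemma expiN n x : expi (- n) x = conjc (expi n x).
Proof. by rewrite /expi /= mulrNz mulNr cosN sinN. Qed.

Lemma expiDr n x y : expi n (x + y) = expi n x * expi n y.
Proof.
apply: complexP; rewrite /expi /= mulrDr.
  by rewrite cosD.
by rewrite sinD; ring.
Qed.

Lemma normc_expi n x : normc (expi n x) = 1.
Proof. by rewrite /expi /= cos2Dsin2 sqrtr1. Qed.

Lemma expi_nat (n : nat) x : expi n x = expi 1 x ^+ n.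
Proof.
elim: n => [|n IH]; first by rewrite expi0 expr0.
by rewrite exprS -IH -expiD.
Qed.

Lemma expi_period n : expi n (2 * pi) = 1 :> R[i].
Proof.
have h1 : expi 1 (2 * pi) = 1 :> R[i].
  by rewrite /expi mul1r mulr_natl cos2pi sin2pi.
case: n => n; first by rewrite expi_nat h1 expr1n.
by rewrite NegzE expiN expi_nat h1 expr1n conjc1.
Qed.

(** Cosine and sine are 1-Lipschitz; the factor 2 comes from bounding the modulus by the sum of the
    two components. *)
Lemma normc_expiB n x y : normc (expi n y - expi n x) <= 2 * `|n%:~R| * `|y - x|.
Proof.
have sin_lip (a b : R) : `|sin a - sin b| <= `|a - b|.
  wlog ba : a b / b <= a.
    by move=> h; case/orP: (le_total b a) => [/h//|/h ab]; rewrite distrC [leRHS]distrC.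
  have cs : {within `[b, a], continuous (@sin R)}.
    by apply: continuous_subspaceT => z; exact: continuous_sin.
  have [c _ ->] := MVT_segment ba (fun x _ => is_derive_sin x) cs.
  by rewrite normrM ler_piMl// cos_max.
have cos_lip (a b : R) : `|cos a - cos b| <= `|a - b|.
  by rewrite -!sinDpihalf; apply: le_trans (sin_lip _ _) _; rewrite opprD addrACA subrr addr0.
apply: le_trans (normc_le_Re_Im _) _.
rewrite -mulrA -normrM mulr_natl mulr2n mulrBr /expi /=.
exact: lerD (cos_lip _ _) (sin_lip _ _).
Qed.

Lemma is_derive_Re_expi (c : R[i]) n x :
  is_derive x 1 (fun y => Re (c * expi n y)) (Re (n%:~R * 'i * c * expi n x)).
Proof.
rewrite (_ : (fun y => Re (c * expi n y)) =
  (fun y => Re c * cos (n%:~R * y) - Im c * sin (n%:~R * y))); last first.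
  by apply/funext => y; rewrite cReM.
have -> : (n%:~R : R[i]) = (n%:~R : R)%:C by rewrite rmorph_int.
apply: is_derive_eq.
by rewrite /GRing.scale /= !mulr1 !cReM !cImM /=; ring.
Qed.

Lemma is_derive_Im_expi (c : R[i]) n x :
  is_derive x 1 (fun y => Im (c * expi n y)) (Im (n%:~R * 'i * c * expi n x)).
Proof.
(* Multiplication by -i reduces the imaginary part to the real part. *)
have h (z : R[i]) : Im z = Re (- 'i * z) by rewrite cReM /=; ring.
have -> : (fun y => Im (c * expi n y)) = (fun y => Re (- 'i * c * expi n y)).
  by apply/funext => y; rewrite h mulrA.
apply: (is_derive_eq (is_derive_Re_expi _ _ _)).
by rewrite [RHS]h; congr Re; ring.
Qed.

End exponentials.

Section symmetric_sums.

(** The sum over -K <= n <= K - 1. The window is half-open, like the frequency range of [S_ N], so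
    that translates of the latter by multiples of 2N can fill it exactly. *)
Definition ssum (V : nmodType) (K : nat) (f : int -> V) : V :=
  \sum_(j < 2 * K) f (freq K j).

Lemma ssum0 (V : nmodType) (f : int -> V) : ssum 0 f = 0.
Proof. by rewrite /ssum muln0 big_ord0. Qed.

Lemma ssumS (V : nmodType) K (f : int -> V) :
  ssum K.+1 f = f (- K.+1%:Z) + ssum K f + f K.
Proof.
rewrite /ssum mulnS big_ord_recl big_ord_recr /= addrA.
congr (_ + _ + _).
- by rewrite /freq sub0r.
- by apply: eq_bigr => i _; congr f; rewrite /freq /bump /=; lia.
- by congr f; rewrite /freq /bump /=; lia.
Qed.

Lemma ssum_telescope (V : zmodType) K (h : int -> V) :
  ssum K (fun n => h (n - 1) - h n) = h (- K%:Z - 1) - h (K%:Z - 1).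
Proof.
elim: K => [|K IH]; first by rewrite ssum0 subrr.
rewrite ssumS IH.
have -> : - K.+1%:Z = - K%:Z - 1 by lia.
have -> : K.+1%:Z - 1 = K by lia.
by rewrite !addrA subrK subrK.
Qed.

(* tiling of [-N(2L+1), N(2L+1)) by the residue classes modulo 2N *)
Lemma ssum_tile (V : nmodType) N L (f : int -> V) :
  ssum (N * (2 * L + 1)) f =
  \sum_(k < 2 * N) (f (freq N k) +
    \sum_(l < L) (f (freq N k + (2 * N * l.+1)%:Z) + f (freq N k - (2 * N * l.+1)%:Z))).
Proof.
elim: L => [|L IH].
  by rewrite muln0 muln1; apply: eq_bigr => k _; rewrite big_ord0 addr0.
under eq_bigr do rewrite big_ord_recr /= addrA.
rewrite big_split/= -IH big_split/= /ssum.
rewrite (_ : 2 * (N * (2 * L.+1 + 1)) = 2 * N + (2 * (N * (2 * L + 1)) + 2 * N))%N; last by lia.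
rewrite big_split_ord/= [X in _ + X]big_split_ord/=.
rewrite addrC -addrA; congr (_ + _).
  by apply: eq_bigr => i _; congr f; rewrite /freq /=; lia.
congr (_ + _).
  by apply: eq_bigr => i _; congr f; rewrite /freq /=; lia.
by apply: eq_bigr => i _; congr f; rewrite /freq /=; lia.
Qed.

Variable R : realType.

Lemma sum_invsqr_le (L : nat) : \sum_(l < L) (l.+1%:R ^- 2 : R) <= 2.
Proof.
(* Strengthened for the induction: (M+2)^-2 <= 1/(M+1) - 1/(M+2) telescopes. *)
suff h M : \sum_(l < M.+1) (l.+1%:R ^- 2 : R) <= 2 - M.+1%:R^-1.
  by case: L => [|L]; [rewrite big_ord0|apply: le_trans (h L) _; rewrite lerBlDr lerDl invr_ge0].
elim: M => [|M IH]; first by rewrite big_ord1 /=; lra.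
rewrite big_ord_recr/=.
have h0 : (0 : R) < M.+1%:R by [].
have h1 : (0 : R) < M.+2%:R by [].
have h : (M.+2%:R ^- 2 : R) <= M.+1%:R^-1 - M.+2%:R^-1; last first.
  by apply: le_trans (lerD IH h) _; rewrite addrA subrK.
have e : (M.+2%:R : R) = M.+1%:R + 1 by rewrite -natr1.
have -> : (M.+1%:R^-1 - M.+2%:R^-1 : R) = (M.+1%:R * M.+2%:R)^-1.
  by rewrite e; field; rewrite -?e !gt_eqF.
rewrite lef_pV2 ?posrE ?exprn_gt0 ?mulr_gt0//.
by rewrite expr2 ler_pM2r// ler_nat.
Qed.

Lemma ssum_invsqr_le K : ssum K (fun n : int => (n%:~R ^- 2 : R)) <= 6.
Proof.
case: K => [|K]; first by rewrite ssum0.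
(* Again a telescoping bound: with a = K + 1 the two new terms satisfy (a+1)^-2 + a^-2 <= 3 / (a
   (a+1)). The term n = 0 counts as 0, since the inverse of 0 is 0. *)
suff h : ssum K.+1 (fun n : int => (n%:~R ^- 2 : R)) <= 6 - 3 / K.+1%:R.
  by apply: le_trans h _; rewrite lerBlDr lerDl divr_ge0.
elim: K => [|K IH].
  rewrite ssumS ssum0 /= mulrNz sqrrN expr1n expr0n /= invr0 invr1; lra.
rewrite ssumS mulrNz sqrrN.
have -> : (K.+2%:Z%:~R : R) = K.+2%:R by [].
have -> : (K.+1%:Z%:~R : R) = K.+1%:R by [].
have h0 : (1 : R) <= K.+1%:R by rewrite ler1n.
have e : (K.+2%:R : R) = K.+1%:R + 1 by rewrite -natr1.
rewrite e {e}; move: (K.+1%:R : R) h0 IH => a h0 IH.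
have h : (a + 1) ^- 2 + a ^- 2 <= 3 / a - 3 / (a + 1); last first.
  rewrite addrAC; apply: le_trans (lerD h IH) _.
  by rewrite addrC addrA subrK.
have a0 : a != 0 by rewrite gt_eqF// (lt_le_trans ltr01).
have a1 : a + 1 != 0 by rewrite gt_eqF// (lt_le_trans ltr01)// (le_trans h0)// lerDl.
rewrite -subr_ge0.
have -> : 3 / a - 3 / (a + 1) - ((a + 1) ^- 2 + a ^- 2) =
  (3 * a * (a + 1) - a ^+ 2 - (a + 1) ^+ 2) / (a ^+ 2 * (a + 1) ^+ 2).
  by field; rewrite a0 a1.
apply: divr_ge0; first by nra.
by rewrite mulr_ge0// sqr_ge0.
Qed.

End symmetric_sums.

(** * Square integrable functions and Bessel's inequality *)

Section square_integrable.
Variable R : realType.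
Implicit Types (f g : R -> R[i]) (c : R[i]).

Notation mu := (@lebesgue_measure R).
Notation D := (`]0, 2 * pi[%classic : set R).

Definition cintegrable f :=
  mu.-integrable D (EFin \o RePart f) /\ mu.-integrable D (EFin \o ImPart f).

(** A real number, so that it can be used in algebraic identities; it is the square of [L2norm] when
    f is in [L2]. *)
Definition sqnorm f : R := \int[mu]_(x in D) (normc (f x) ^+ 2).

Lemma measurable_period : measurable (D : set (measurableTypeR R)). Proof. exact: measurable_itv. Qed.

Lemma mu_periodE : mu D = (2 * pi)%:E.
Proof. by rewrite lebesgue_measure_itv/= lte_fin mulr_gt0 ?pi_gt0// oppr0 adde0. Qed.

Lemma mu_period : (mu D < +oo)%E. Proof. by rewrite mu_periodE ltry. Qed.

Let eq_integrable (h k : R -> \bar R) : h =1 k ->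
  mu.-integrable D h -> mu.-integrable D k.
Proof. by move/funext->. Qed.

Lemma cintegrableD f g :
  cintegrable f -> cintegrable g -> cintegrable (fun x => f x + g x).
Proof.
move=> [rf jf] [rg jg]; split.
  apply: (eq_integrable _ (integrableD measurable_period rf rg)) => x.
  by rewrite /RePart /= cReD EFinD.
apply: (eq_integrable _ (integrableD measurable_period jf jg)) => x.
by rewrite /ImPart /= cImD EFinD.
Qed.

Lemma cintegralD f g : cintegrable f -> cintegrable g ->
  cintegral (fun x => f x + g x) = cintegral f + cintegral g.
Proof.
move=> [rf jf] [rg jg]; apply: complexP; rewrite ?cReD ?cImD /cintegral/=.
  rewrite -RintegralD//; apply: eq_Rintegral => x _.
  by rewrite /RePart cReD.
rewrite -RintegralD//; apply: eq_Rintegral => x _.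
by rewrite /ImPart cImD.
Qed.

Lemma cintegrableZ c f : cintegrable f -> cintegrable (fun x => c * f x).
Proof.
move=> [rf jf]; split.
  apply: (eq_integrable _ (integrableB measurable_period
    (integrableZl measurable_period (Re c) rf)
    (integrableZl measurable_period (Im c) jf))) => x.
  by rewrite /comp /RePart /ImPart cReM EFinB !EFinM.
apply: (eq_integrable _ (integrableD measurable_period
  (integrableZl measurable_period (Re c) jf)
  (integrableZl measurable_period (Im c) rf))) => x.
by rewrite /comp /RePart /ImPart cImM addrC EFinD !EFinM addeC.
Qed.

Lemma integrableZl_EFin (a : R) (h : R -> R) : mu.-integrable D (EFin \o h) ->
  mu.-integrable D (EFin \o (fun x => a * h x)).
Proof.
move=> ih; apply: (eq_integrable _ (integrableZl measurable_period a ih)) => x.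
by rewrite /= EFinM.
Qed.

Lemma cintegralZ c f : cintegrable f ->
  cintegral (fun x => c * f x) = c * cintegral f.
Proof.
move=> [rf jf]; apply: complexP; rewrite ?cReM ?cImM /cintegral/=.
  rewrite -!RintegralZl// -RintegralB//; last 2 first.
  - exact: integrableZl_EFin.
  - exact: integrableZl_EFin.
  by apply: eq_Rintegral => x _; rewrite /RePart /ImPart cReM.
rewrite -!RintegralZl// -RintegralD//; last 2 first.
- exact: integrableZl_EFin.
- exact: integrableZl_EFin.
by apply: eq_Rintegral => x _; rewrite /RePart /ImPart cImM.
Qed.

Lemma cintegrable0 : cintegrable (fun=> 0).
Proof. by split; exact: integrable0. Qed.

Lemma cintegral0 : cintegral (fun=> 0) = 0 :> R[i].
Proof.
by apply: complexP; rewrite /cintegral /RePart /ImPart /= Rintegral_cst ?mul0r.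
Qed.

Lemma cintegrable_sum (I : Type) (r : seq I) (F : I -> R -> R[i]) :
  (forall i, cintegrable (F i)) -> cintegrable (fun x => \sum_(i <- r) F i x).
Proof.
move=> iF; elim: r => [|i r IH].
  by under eq_fun do rewrite big_nil; exact: cintegrable0.
by under eq_fun do rewrite big_cons; exact: cintegrableD.
Qed.

Lemma cintegral_sum (I : Type) (r : seq I) (F : I -> R -> R[i]) :
  (forall i, cintegrable (F i)) ->
  cintegral (fun x => \sum_(i <- r) F i x) = \sum_(i <- r) cintegral (F i).
Proof.
move=> iF; elim: r => [|i r IH].
  by under eq_fun do rewrite big_nil; rewrite cintegral0 big_nil.
under eq_fun do rewrite big_cons.
by rewrite cintegralD ?IH ?big_cons//; exact: cintegrable_sum.
Qed.

Lemma cintegrable_conj f : cintegrable f -> cintegrable (fun x => conjc (f x)).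
Proof.
move=> [rf jf]; split.
  by apply: (eq_integrable _ rf) => x; rewrite /RePart /=; case: (f x).
by apply: (eq_integrable _ (integrableN jf)) => x; rewrite /ImPart /=; case: (f x).
Qed.

Lemma cintegral_conj f : cintegrable f ->
  cintegral (fun x => conjc (f x)) = conjc (cintegral f).
Proof.
move=> [rf jf]; apply: complexP; rewrite /cintegral/=.
  by apply: eq_Rintegral => x _; rewrite /RePart /=; case: (f x).
rewrite -mulN1r -RintegralZl//; apply: eq_Rintegral => x _.
by rewrite /ImPart /= mulN1r; case: (f x).
Qed.

Lemma L2normE f :
  L2norm f = ((\int[mu]_(x in D) (normc (f x) ^+ 2)%:E) `^ 2^-1)%E.
Proof.
rewrite /L2norm unlock; congr (_ `^ _)%E.
rewrite [RHS]integral_mkcond; apply: eq_integral => x _.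
rewrite /patch; case: ifP => _ /=.
  by rewrite ger0_norm ?normc_ge0// powR_mulrn ?normc_ge0.
by rewrite normr0 powR0.
Qed.

Lemma measurable_sqr_normc f : measurable_fun D (RePart f) ->
  measurable_fun D (ImPart f) -> measurable_fun D (fun x => normc (f x) ^+ 2).
Proof.
move=> mr mi.
rewrite (_ : (fun x => _) = (fun x => RePart f x ^+ 2 + ImPart f x ^+ 2)).
  by apply: measurable_funD; apply: measurable_funX.
by apply/funext => x; rewrite sqr_normc2.
Qed.

Lemma L2_integrable f : L2 f ->
  mu.-integrable D (EFin \o (fun x => normc (f x) ^+ 2)).
Proof.
move=> [mr mi fin]; apply/integrableP; split.
  by apply/measurable_EFinP; apply: measurable_sqr_normc.
rewrite ltNge leye_eq; apply/negP => /eqP h.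
move: fin; rewrite L2normE.
under eq_integral do rewrite -[X in X%:E]ger0_norm ?sqr_ge0//.
by rewrite [X in (X `^ _)%E]h poweRyr// ltxx.
Qed.

Lemma sqnorm_ge0 f : 0 <= sqnorm f.
Proof. by apply: Rintegral_ge0 => x _; exact: sqr_ge0. Qed.

Lemma L2norm_sqnorm f : L2 f -> L2norm f = (Num.sqrt (sqnorm f))%:E.
Proof.
move=> L2f; rewrite L2normE -powR12_sqrt ?sqnorm_ge0// -poweR_EFin.
congr (_ `^ _)%E; rewrite fineK//.
exact: (integrable_fin_num measurable_period (L2_integrable L2f)).
Qed.

Lemma L2_of_integrable f : measurable_fun D (RePart f) ->
  measurable_fun D (ImPart f) ->
  mu.-integrable D (EFin \o (fun x => normc (f x) ^+ 2)) -> L2 f.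
Proof.
move=> mr mi int; split => //; rewrite L2normE.
rewrite poweR_lty//.
exact: (integral_fune_lt_pinfty measurable_period int).
Qed.

Lemma L2_bounded f (M : R) : measurable_fun D (RePart f) ->
  measurable_fun D (ImPart f) -> (forall x, D x -> normc (f x) <= M) -> L2 f.
Proof.
move=> mr mi fM; apply: L2_of_integrable => //.
apply: measurable_bounded_integrable.
- exact: measurable_period.
- exact: mu_period.
- exact: measurable_sqr_normc.
exists (M ^+ 2); split; first exact: num_real.
move=> x Mx y Dy; apply: le_trans (ltW Mx).
rewrite ger0_norm ?sqr_ge0// lerXn2r ?nnegrE ?normc_ge0 ?fM//.
exact: le_trans (normc_ge0 _) (fM _ Dy).
Qed.

Lemma L2D f g : L2 f -> L2 g -> L2 (fun x => f x + g x).
Proof.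
move=> L2f L2g; have [mrf mif _] := L2f; have [mrg mig _] := L2g.
have mr : measurable_fun D (RePart (fun x => f x + g x)).
  under [X in measurable_fun _ X]eq_fun do rewrite /RePart cReD.
  exact: measurable_funD.
have mi : measurable_fun D (ImPart (fun x => f x + g x)).
  under [X in measurable_fun _ X]eq_fun do rewrite /ImPart cImD.
  exact: measurable_funD.
apply: L2_of_integrable => //.
apply: (le_integrable measurable_period _ _ (integrableD measurable_period
  (integrableZl_EFin 2 (L2_integrable L2f)) (integrableZl_EFin 2 (L2_integrable L2g)))).
  by apply/measurable_EFinP; apply: measurable_sqr_normc.
move=> x _ /=; rewrite lee_fin !ger0_norm ?addr_ge0 ?mulr_ge0 ?sqr_ge0 ?normc_ge0//.
rewrite !sqr_normc2 cReD cImD -subr_ge0.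
(* Parallelogram identity: 2 |f|^2 + 2 |g|^2 - |f + g|^2 = |f - g|^2. *)
rewrite [leRHS](_ : _ = (Re (f x) - Re (g x)) ^+ 2 + (Im (f x) - Im (g x)) ^+ 2); last by ring.
by rewrite addr_ge0 ?sqr_ge0.
Qed.

Lemma L2Z c f : L2 f -> L2 (fun x => c * f x).
Proof.
move=> L2f; have [mrf mif _] := L2f.
have mr : measurable_fun D (RePart (fun x => c * f x)).
  under [X in measurable_fun _ X]eq_fun do rewrite /RePart cReM.
  by apply: measurable_funB; apply: measurable_funM.
have mi : measurable_fun D (ImPart (fun x => c * f x)).
  under [X in measurable_fun _ X]eq_fun do rewrite /ImPart cImM.
  by apply: measurable_funD; apply: measurable_funM.
apply: L2_of_integrable => //.
apply: (eq_integrable _ (integrableZl_EFin (normc c ^+ 2) (L2_integrable L2f))) => x.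
by rewrite /= Normc.normcM exprMn.
Qed.

Lemma L2_cintegrableM f g : L2 f -> L2 g -> cintegrable (fun x => f x * g x).
Proof.
move=> L2f L2g; have [mrf mif _] := L2f; have [mrg mig _] := L2g.
have le x : normc (f x * g x) <= normc (f x) ^+ 2 + normc (g x) ^+ 2.
  rewrite Normc.normcM.
  by have := normc_ge0 (f x); have := normc_ge0 (g x); nra.
have int := integrableD measurable_period (L2_integrable L2f) (L2_integrable L2g).
split; apply: (le_integrable measurable_period _ _ int).
- apply/measurable_EFinP.
  under [X in measurable_fun _ X]eq_fun do rewrite /RePart cReM.
  by apply: measurable_funB; apply: measurable_funM.
- move=> x _ /=; rewrite lee_fin [leRHS]ger0_norm ?addr_ge0 ?sqr_ge0//.
  exact: le_trans (normc_Re _) (le x).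
- apply/measurable_EFinP.
  under [X in measurable_fun _ X]eq_fun do rewrite /ImPart cImM.
  by apply: measurable_funD; apply: measurable_funM.
- move=> x _ /=; rewrite lee_fin [leRHS]ger0_norm ?addr_ge0 ?sqr_ge0//.
  exact: le_trans (normc_Im _) (le x).
Qed.

Lemma continuous_expi n :
  continuous (RePart (@expi R n)) /\ continuous (ImPart (@expi R n)).
Proof.
split=> x; rewrite /RePart /ImPart /=.
  apply: continuous_comp; last exact: continuous_cos.
  exact: mulrl_continuous.
apply: continuous_comp; last exact: continuous_sin.
exact: mulrl_continuous.
Qed.

Lemma L2_expi n : L2 (@expi R n).
Proof.
have [cr ci] := continuous_expi n.
apply: (@L2_bounded _ 1); last by move=> x _; rewrite normc_expi.
  by apply: measurable_funTS; exact: continuous_measurable_fun.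
by apply: measurable_funTS; exact: continuous_measurable_fun.
Qed.

Lemma L2_cst c : L2 (fun _ : R => c).
Proof.
have := L2Z c (L2_expi 0); congr L2.
by apply/funext => x; rewrite expi0 mulr1.
Qed.

Lemma L2_sum (I : Type) (r : seq I) (F : I -> R -> R[i]) :
  (forall i, L2 (F i)) -> L2 (fun x => \sum_(i <- r) F i x).
Proof.
move=> iF; elim: r => [|i r IH].
  by under eq_fun do rewrite big_nil; exact: L2_cst.
by under eq_fun do rewrite big_cons; exact: L2D.
Qed.

Lemma L2_conj f : L2 f -> L2 (fun x => conjc (f x)).
Proof.
move=> L2f; have [mr mi _] := L2f.
apply: L2_of_integrable.
- rewrite (_ : RePart _ = RePart f)//.
  by apply/funext => x; rewrite /RePart; case: (f x).
- rewrite (_ : ImPart _ = (fun x => - ImPart f x)); first exact: measurableT_comp.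
  by apply/funext => x; rewrite /ImPart; case: (f x).
- rewrite (_ : (fun x => normc _ ^+ 2) = (fun x => normc (f x) ^+ 2)).
    exact: L2_integrable.
  by apply/funext => x; rewrite normc_conj.
Qed.

Lemma L2_cintegrable f : L2 f -> cintegrable f.
Proof.
move=> L2f; have := L2_cintegrableM L2f (L2_cst 1).
by under eq_fun do rewrite mulr1.
Qed.

Lemma sqnormE f : L2 f -> (sqnorm f)%:C = cintegral (fun x => f x * conjc (f x)).
Proof.
move=> L2f; apply: complexP; rewrite /cintegral /=.
  by apply: eq_Rintegral => x _; rewrite /RePart -sqr_normcJ.
rewrite -[LHS](mul0r (fine (mu D))) -Rintegral_cst; last exact: measurable_period.
by apply: eq_Rintegral => x _; rewrite /ImPart -sqr_normcJ.
Qed.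

Lemma Rintegral_derivative (F f : R -> R) : continuous f ->
  (forall x : R, is_derive x (1 : R) F (f x)) ->
  \int[mu]_(x in D) f x = F (2 * pi) - F 0.
Proof.
move=> cf dF; have pi2 : (0 : R) < 2 * pi by rewrite mulr_gt0// pi_gt0.
have cF : continuous F.
  by move=> x; apply: differentiable_continuous; apply/derivable1_diffP; case: (dF x).
rewrite /Rintegral -(integral_itv_bndoo true false); last first.
  by apply/measurable_EFinP/measurable_funTS; exact: continuous_measurable_fun.
rewrite (@continuous_FTC2 _ f F)//.
- exact: continuous_subspaceT.
- split => [x _| |].
  + by case: (dF x).
  + exact/cvg_at_right_filter/cF.
  + exact/cvg_at_left_filter/cF.
- by move=> x _; rewrite derive1E; apply: derive_val.
Qed.

(** For n <> 0 the function e^{inx} / (in) is a primitive taking equal values at 0 and 2 pi. This is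
    the orthogonality of the exponentials. *)
Lemma cintegral_expi n : cintegral (@expi R n) = if n == 0 then (2 * pi)%:C else 0.
Proof.
have [->|n0] := eqVneq n 0.
  apply: complexP; rewrite /cintegral /RePart /ImPart /=.
    under eq_Rintegral do rewrite mul0r cos0.
    rewrite Rintegral_cst; last exact: measurable_period.
    by rewrite mul1r [X in fine X]mu_periodE.
  under eq_Rintegral do rewrite mul0r sin0.
  by rewrite Rintegral_cst ?mul0r//; exact: measurable_period.
have [cr ci] := continuous_expi n.
pose c : R[i] := (n%:~R * 'i)^-1.
have c1 : n%:~R * 'i * c = 1.
  rewrite mulfV// mulf_neq0 ?intr_eq0//.
  by apply/eqP => /(congr1 (@Im R)) /= /eqP; rewrite oner_eq0.
have dr (x : R) : is_derive x (1 : R) (fun x => Re (c * expi n x)) (RePart (expi n) x).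
  by apply: is_derive_eq (is_derive_Re_expi c n x) _; rewrite c1 mul1r.
have di (x : R) : is_derive x (1 : R) (fun x => Im (c * expi n x)) (ImPart (expi n) x).
  by apply: is_derive_eq (is_derive_Im_expi c n x) _; rewrite c1 mul1r.
apply: complexP; rewrite /cintegral /=.
  by rewrite (Rintegral_derivative cr dr) expi_period expi_at0 subrr.
by rewrite (Rintegral_derivative ci di) expi_period expi_at0 subrr.
Qed.

Definition fcoef f (n : int) : R[i] :=
  (2 * pi)%:C^-1 * cintegral (fun x => f x * expi (- n) x).

Arguments fcoef : simpl never.

Lemma two_pi_neq0 : (2 * pi)%:C != 0 :> R[i].
Proof. by rewrite (_ : 0 = 0%:C)// (inj_eq (@complexI _)) mulf_neq0 ?gt_eqF ?pi_gt0. Qed.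

Lemma cintegral_fcoef f n :
  cintegral (fun x => f x * expi (- n) x) = (2 * pi)%:C * fcoef f n.
Proof. by rewrite /fcoef mulrA mulfV ?two_pi_neq0// mul1r. Qed.

Lemma L2_ssum K (a : int -> R[i]) : L2 (fun x : R => ssum K (fun n => a n * expi n x)).
Proof. by apply: L2_sum => i; apply/L2Z/L2_expi. Qed.

Lemma freq_inj K (i j : 'I_(2 * K)) : (freq K i == freq K j) = (i == j).
Proof. by rewrite /freq (inj_eq (addIr _)). Qed.

Lemma fcoef_ssum K (a : int -> R[i]) (j : 'I_(2 * K)) :
  fcoef (fun x => ssum K (fun n => a n * expi n x)) (freq K j) = a (freq K j).
Proof.
rewrite /fcoef (_ : (fun x => _) = (fun x : R => \sum_(i < 2 * K)
   a (freq K i) * expi (freq K i - freq K j) x)); last first.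
  apply/funext => x; rewrite /ssum mulr_suml; apply: eq_bigr => i _.
  by rewrite expiD mulrA.
have ie n : cintegrable (@expi R n) by exact/L2_cintegrable/L2_expi.
rewrite cintegral_sum; last by move=> i; exact: cintegrableZ.
rewrite (bigD1 j)//= big1 ?addr0; last first.
  move=> i ij; rewrite cintegralZ// cintegral_expi subr_eq0 freq_inj (negbTE ij).
  by rewrite mulr0.
by rewrite cintegralZ// cintegral_expi subrr eqxx mulrC mulfK// two_pi_neq0.
Qed.

Lemma conj_ssum K (a : int -> R[i]) (x : R) :
  conjc (ssum K (fun n => a n * expi n x)) =
  \sum_(i < 2 * K) conjc (a (freq K i)) * expi (- freq K i) x.
Proof.
rewrite /ssum rmorph_sum; apply: eq_bigr => i _; rewrite expiN; exact: conjM.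
Qed.

Lemma sqnorm_ssum K (a : int -> R[i]) :
  sqnorm (fun x => ssum K (fun n => a n * expi n x)) =
  2 * pi * ssum K (fun n => normc (a n) ^+ 2).
Proof.
apply: complexI; set S := fun x : R => _.
have L2S : L2 S by exact: L2_ssum.
rewrite sqnormE//.
rewrite (_ : (fun x => _) = (fun x : R => \sum_(i < 2 * K)
   conjc (a (freq K i)) * (S x * expi (- freq K i) x))); last first.
  apply/funext => x; rewrite {2}/S conj_ssum mulr_sumr; apply: eq_bigr => i _.
  by rewrite mulrCA.
have iS n : cintegrable (fun x => S x * expi n x).
  exact: L2_cintegrableM L2S (L2_expi _).
rewrite cintegral_sum; last by move=> i; exact: cintegrableZ.
rewrite rmorphM /= /ssum rmorph_sum /= mulr_sumr; apply: eq_bigr => i _.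
rewrite cintegralZ// cintegral_fcoef fcoef_ssum sqr_normcJ; ring.
Qed.

(* expands 0 <= |f - S|^2, where S is the partial Fourier sum of f *)
Lemma bessel f K : L2 f ->
  2 * pi * ssum K (fun n => normc (fcoef f n) ^+ 2) <= sqnorm f.
Proof.
move=> L2f; have [a aE] : {a | a = fcoef f} by exists (fcoef f).
rewrite -aE; pose S (x : R) : R[i] := ssum K (fun n => a n * expi n x).
have L2S : L2 S by exact: L2_ssum.
have L2fS : L2 (fun x => f x - S x).
  have := L2D L2f (L2Z (-1) L2S); congr L2.
  by apply/funext => x; rewrite mulN1r.
rewrite -subr_ge0; suff <- : sqnorm (fun x => f x - S x) =
    sqnorm f - 2 * pi * ssum K (fun n => normc (a n) ^+ 2).
  exact: sqnorm_ge0.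
have cL2f := L2_conj L2f; have cL2S := L2_conj L2S.
have ifS : cintegrable (fun x => f x * conjc (S x)) by exact: L2_cintegrableM.
(* Since f and S have the same coefficients on the window, the cross term is real and equal to the
   squared norm of S. *)
have hfS : cintegral (fun x => f x * conjc (S x)) =
    (2 * pi * ssum K (fun n => normc (a n) ^+ 2))%:C.
  rewrite (_ : (fun x => _) = (fun x : R => \sum_(i < 2 * K)
     conjc (a (freq K i)) * (f x * expi (- freq K i) x))); last first.
    apply/funext => x; rewrite /S conj_ssum mulr_sumr; apply: eq_bigr => i _.
    by rewrite mulrCA.
  have iS n : cintegrable (fun x => f x * expi n x).
    exact: L2_cintegrableM L2f (L2_expi _).
  rewrite cintegral_sum; last by move=> i; exact: cintegrableZ.
  rewrite rmorphM /= /ssum rmorph_sum /= mulr_sumr; apply: eq_bigr => i _.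
  rewrite cintegralZ// cintegral_fcoef -aE sqr_normcJ; ring.
apply: complexI; rewrite rmorphB /= !sqnormE//.
rewrite (_ : (fun x => _) = (fun x : R => (f x * conjc (f x) + S x * conjc (S x)) +
   (-1) * (f x * conjc (S x) + conjc (f x * conjc (S x))))); last first.
  apply/funext => x; case: (f x) (S x) => p q [v w].
  by apply: complexP => /=; ring.
rewrite cintegralD; last 2 first.
- by apply: cintegrableD; exact: L2_cintegrableM.
- by apply/cintegrableZ/cintegrableD => //; exact: cintegrable_conj.
rewrite cintegralD; [|exact: L2_cintegrableM..].
rewrite cintegralZ; last by apply: cintegrableD => //; exact: cintegrable_conj.
rewrite cintegralD//; last exact: cintegrable_conj.
rewrite cintegral_conj// hfS -[in X in _ + X + _]sqnormE// sqnorm_ssum conjc_real.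
by rewrite addrAC; ring.
Qed.

End square_integrable.

(** * Periodic derivatives and decay of Fourier coefficients *)

Section periodic_derivatives.
Variable R : realType.
Implicit Types (v w : R -> R[i]) (c : R[i]).

Lemma derive1n_expi c (m : int) n :
  derive1n n (RePart (fun x : R => c * expi m x)) =
    RePart (fun x => (m%:~R * 'i) ^+ n * c * expi m x) /\
  derive1n n (ImPart (fun x : R => c * expi m x)) =
    ImPart (fun x => (m%:~R * 'i) ^+ n * c * expi m x).
Proof.
elim: n => [|n [IHr IHi]]; first by rewrite expr0 !mul1r.
rewrite !derive1nS IHr IHi; split; apply/funext => x; rewrite derive1E.
  have [_ ->] := is_derive_Re_expi ((m%:~R * 'i) ^+ n * c) m x.
  by rewrite /RePart exprS !mulrA.
have [_ ->] := is_derive_Im_expi ((m%:~R * 'i) ^+ n * c) m x.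
by rewrite /ImPart exprS !mulrA.
Qed.

Lemma cderive1n_expi (m : int) n (x : R) :
  cderive1n n (expi m) x = (m%:~R * 'i) ^+ n * expi m x.
Proof.
rewrite /cderive1n (_ : expi m = fun x : R => 1 * expi m x); last first.
  by apply/funext => y; rewrite mul1r.
have [-> ->] := derive1n_expi 1 m n.
by rewrite mulr1 /RePart /ImPart mul1r; case: (_ * _).
Qed.

Lemma smooth_periodic_expi (m : int) : smooth_periodic (@expi R m).
Proof.
split=> [x|n x]; first by rewrite expiDr expi_period mulr1.
rewrite (_ : expi m = fun x : R => 1 * expi m x); last first.
  by apply/funext => y; rewrite mul1r.
have [-> ->] := derive1n_expi 1 m n.
split; first by have [] := is_derive_Re_expi ((m%:~R * 'i) ^+ n * 1) m x.
by have [] := is_derive_Im_expi ((m%:~R * 'i) ^+ n * 1) m x.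
Qed.

(** The test function is e^{-inx}: its k-th derivative is (-in)^k times itself, and the sign cancels
    the (-1)^k of the integration by parts. *)
Lemma fcoef_pderiv k v w n : L2 v -> is_pderiv k v w ->
  fcoef w n = (n%:~R * 'i) ^+ k * fcoef v n.
Proof.
move=> L2v /(_ _ (smooth_periodic_expi (- n))).
rewrite (_ : (fun x => v x * _) =
    (fun x => ((- n)%:~R * 'i) ^+ k * (v x * expi (- n) x))); last first.
  by apply/funext => x; rewrite cderive1n_expi mulrCA.
rewrite cintegralZ; last exact: L2_cintegrableM L2v (L2_expi _ _).
have n1 : (-1 : R[i]) ^+ k != 0 by rewrite expf_neq0// oppr_eq0 oner_eq0.
rewrite mulrNz mulNr -mulN1r exprMn -mulrA => h0; have h := mulfI n1 h0.
by rewrite /fcoef -h mulrCA.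
Qed.

Lemma pderivP s k v : Hp s v -> (k <= s)%N ->
  L2 (pderiv k v) /\ is_pderiv k v (pderiv k v).
Proof.
move=> [_ h] ks; have [w L2w vw] := h k ks.
by apply: (@xgetPex _ _ [set w | L2 w /\ is_pderiv k v w]); exists w.
Qed.

Lemma normc_freqX (n : int) k : normc ((n%:~R * 'i) ^+ k : R[i]) = `|n%:~R| ^+ k.
Proof. by rewrite normcX Normc.normcM normc_int normci mulr1. Qed.

Lemma fcoef_decay s v K : Hp s v ->
  2 * pi * ssum K (fun n => (`|n%:~R| ^+ s * normc (fcoef v n)) ^+ 2) <=
  sqnorm (pderiv s v).
Proof.
move=> Hv; have [L2d d] := pderivP Hv (leqnn s).
apply: le_trans (bessel K L2d); rewrite ler_pM2l ?mulr_gt0 ?pi_gt0//.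
apply: ler_sum => i _; rewrite (fcoef_pderiv _ _ d); last by case: Hv.
by rewrite [in leRHS]Normc.normcM normc_freqX.
Qed.

End periodic_derivatives.

(** * Convergence of complex sequences by components *)

Section componentwise_convergence.
Variable R : realType.
Implicit Types (z w : nat -> R[i]) (l m : R[i]).

(** Limits are taken by components because the derivatives of the problem are. *)
Definition ccvg z l :=
  ((fun n => Re (z n)) @ \oo --> Re l) /\ ((fun n => Im (z n)) @ \oo --> Im l).

Lemma ccvg_cst l : ccvg (fun=> l) l.
Proof. by split; exact: cvg_cst. Qed.

Lemma ccvgD z w l m : ccvg z l -> ccvg w m -> ccvg (fun n => z n + w n) (l + m).
Proof.
move=> [zr zi] [wr wi]; split; rewrite ?cReD ?cImD.
  by under eq_fun do rewrite cReD; exact: cvgD.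
by under eq_fun do rewrite cImD; exact: cvgD.
Qed.

Lemma ccvgM z w l m : ccvg z l -> ccvg w m -> ccvg (fun n => z n * w n) (l * m).
Proof.
move=> [zr zi] [wr wi]; split; rewrite ?cReM ?cImM.
  by under eq_fun do rewrite cReM; apply: cvgB; exact: cvgM.
by under eq_fun do rewrite cImM; apply: cvgD; exact: cvgM.
Qed.

Lemma ccvgB z w l m : ccvg z l -> ccvg w m -> ccvg (fun n => z n - w n) (l - m).
Proof.
move=> zl wm; rewrite -mulN1r (_ : (fun n => _) = fun n => z n + -1 * w n).
  by apply: ccvgD => //; apply: ccvgM => //; exact: ccvg_cst.
by apply/funext => n; rewrite mulN1r.
Qed.

Lemma ccvg_sum (I : Type) (r : seq I) (Z : I -> nat -> R[i]) (L : I -> R[i]) :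
  (forall i, ccvg (Z i) (L i)) ->
  ccvg (fun n => \sum_(i <- r) Z i n) (\sum_(i <- r) L i).
Proof.
move=> h; elim: r => [|i r IH].
  by under eq_fun do rewrite big_nil; rewrite big_nil; exact: ccvg_cst.
under eq_fun do rewrite big_cons; rewrite big_cons; exact: ccvgD.
Qed.

Lemma ccvg_subseq z l (phi : nat -> nat) : (forall n, (n <= phi n)%N) ->
  ccvg z l -> ccvg (z \o phi) l.
Proof.
move=> h; have cphi : phi @ \oo --> \oo.
  move=> A [N _ NA]; exists N => // n /= Nn; apply: NA => /=.
  exact: leq_trans Nn (h n).
by move=> [zr zi]; split; [exact: (cvg_comp phi _ cphi zr)|exact: (cvg_comp phi _ cphi zi)].
Qed.

Lemma ccvg_dist z l (e : nat -> R) : (\forall n \near \oo, normc (z n - l) <= e n) ->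
  e @ \oo --> 0 -> ccvg z l.
Proof.
move=> ze e0; split; apply/cvgrPdist_le => eps eps0.
  near=> n; rewrite distrC -cReN -cReD; apply: le_trans (normc_Re _) _.
  apply: (@le_trans _ _ (e n)); first by near: n.
  by near: n; apply: (cvgr_le _ e0).
near=> n; rewrite distrC -cImN -cImD; apply: le_trans (normc_Im _) _.
apply: (@le_trans _ _ (e n)); first by near: n.
by near: n; apply: (cvgr_le _ e0).
Unshelve. all: by end_near. Qed.

Lemma ccvg_sqr_normc z l : ccvg z l ->
  (fun n => normc (z n) ^+ 2) @ \oo --> normc l ^+ 2.
Proof.
move=> [zr zi]; rewrite sqr_normc2; under eq_fun do rewrite sqr_normc2 !expr2.
by rewrite !expr2; apply: cvgD; exact: cvgM.
Qed.

End componentwise_convergence.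

(** * The Riemann-Lebesgue lemma for square integrable functions *)

Section riemann_lebesgue.
Variable R : realType.

Lemma ssum_nondecreasing (f : int -> R) : (forall n, 0 <= f n) ->
  {homo (fun K => ssum K f) : m n / (m <= n)%N >-> m <= n}.
Proof.
move=> f0; apply: homo_leq; [exact: lexx|exact: le_trans|move=> K].
by rewrite ssumS addrAC lerDr addr_ge0.
Qed.

Lemma ssum_is_cvgn (f : int -> R) (B : R) : (forall n, 0 <= f n) ->
  (forall K, ssum K f <= B) -> cvgn (fun K => ssum K f).
Proof.
move=> f0 fB; apply: nondecreasing_is_cvgn; first exact: ssum_nondecreasing.
by exists B => _ [K _ <-].
Qed.

(** By Bessel the sums of |c n|^2 over growing windows converge, so their increments tend to 0; the
    increment from K to K + 1 is the sum of the terms at K and -(K+1). *)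
Lemma fcoef_cvg0 (f : R -> R[i]) : L2 f ->
  (fun K : nat => normc (fcoef f K)) @ \oo --> (0 : R) /\
  (fun K : nat => normc (fcoef f (- K.+1%:Z))) @ \oo --> (0 : R).
Proof.
move=> L2f; pose g n := normc (fcoef f n) ^+ 2.
have g0 n : 0 <= g n by exact: sqr_ge0.
have pi2 : (0 : R) < 2 * pi by rewrite mulr_gt0 ?pi_gt0.
have cg : cvgn (fun K => ssum K g).
  apply: (ssum_is_cvgn (B := sqnorm f / (2 * pi))) => // K.
  by rewrite ler_pdivlMr// mulrC bessel.
have d0 : (fun K => ssum K.+1 g - ssum K g) @ \oo --> (0 : R).
  rewrite -[X in _ --> X](subrr (limn (fun K => ssum K g))).
  by apply: cvgB => //; rewrite (cvg_shiftS (fun K => ssum K g)).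
have sq0 (h : nat -> R[i]) : (forall K, normc (h K) ^+ 2 <= ssum K.+1 g - ssum K g) ->
    (fun K : nat => normc (h K)) @ \oo --> (0 : R).
  move=> hle; have h2 : (fun K : nat => normc (h K) ^+ 2) @ \oo --> (0 : R).
    apply: (squeeze_cvgr _ (@cvg_cst _ 0 _ _ _) d0).
    by apply: nearW => K; rewrite sqr_ge0 hle.
  rewrite (_ : (fun K => normc (h K)) = fun K => Num.sqrt (normc (h K) ^+ 2)).
    by rewrite -[X in _ --> X]sqrtr0; apply: continuous_cvg => //; exact: sqrt_continuous.
  by apply/funext => K; rewrite sqrtr_sqr ger0_norm ?normc_ge0.
have dE K : ssum K.+1 g - ssum K g = g (- K.+1%:Z) + g K.
  by rewrite ssumS addrAC addrK.
split; apply: sq0 => K; rewrite dE.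
  by rewrite lerDr.
by rewrite lerDl.
Qed.

End riemann_lebesgue.

(** * One-sided derivatives *)

Section one_sided_derivatives.
Variable R : realType.
Implicit Types (D : set R) (f g : R -> R[i]) (x y : R) (c : R[i]).

(** The relational form of [deriv_in]: it passes to sums without any uniqueness of limits, which is
    needed only when the value is finally read off. *)
Definition has_deriv_in D f x (l : R[i]) :=
  (quotient (RePart f) x @ within D x^' --> Re l) /\
  (quotient (ImPart f) x @ within D x^' --> Im l).

(** Gives uniqueness of the one-sided limits. Near x there is another point of the interval: to the
    right if x < b, to the left if x = b, cut off at the end of the interval in either case. *)
Lemma within_itv_proper (a b x : R) : a < b -> x \in `[a, b] ->
  ProperFilter (within `[a, b] x^').
Proof.
move=> ab; rewrite in_itv/= => /andP[ax xb]; apply: Build_ProperFilter.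
rewrite /within /= => /nbhs_ballP[e /= e0 he].
have [xlt|xge] := ltP x b.
  pose y := Num.min (x + e / 2) b.
  have xy : x < y by rewrite lt_min xlt andbT ltrDl divr_gt0.
  apply: (he y); rewrite /= ?gt_eqF//.
    rewrite -ball_normE /= distrC gtr0_norm ?subr_gt0// ltrBlDl.
    by rewrite (le_lt_trans (y := x + e / 2)) ?ge_min ?lexx// ltrD2l ltr_pdivrMr// ltr_pMr// ltr1n.
  by rewrite in_itv /= (le_trans ax (ltW xy)) ge_min lexx orbT.
have xE : x = b by apply/eqP; rewrite eq_le xb xge.
pose y := Num.max (x - e / 2) a.
have yx : y < x by rewrite gt_max xE ab andbT ltrBlDr ltrDl divr_gt0.
apply: (he y); rewrite /= ?lt_eqF//.
  rewrite -ball_normE /= gtr0_norm ?subr_gt0// ltrBlDl -ltrBlDr.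
  by rewrite (lt_le_trans (y := x - e / 2)) ?le_max ?lexx// ltrD2l ltrN2 ltr_pdivrMr// ltr_pMr// ltr1n.
by rewrite in_itv /= le_max lexx orbT /= (le_trans (ltW yx)).
Qed.

Lemma derivable_in_has D f x : derivable_in D f x ->
  has_deriv_in D f x (deriv_in D f x).
Proof. by case. Qed.

Lemma has_deriv_inE D f x l : ProperFilter (within D x^') ->
  has_deriv_in D f x l -> deriv_in D f x = l.
Proof.
move=> pf [hr hi]; apply: complexP => /=; exact: cvg_lim.
Qed.

Lemma has_deriv_in_cst D c x : has_deriv_in D (fun=> c) x 0.
Proof.
by split; rewrite /quotient /RePart /ImPart /=;
  under eq_fun do rewrite subrr mul0r; exact: cvg_cst.
Qed.

Lemma has_deriv_inD D f g x l m : has_deriv_in D f x l -> has_deriv_in D g x m ->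
  has_deriv_in D (fun y => f y + g y) x (l + m).
Proof.
move=> [fr fi] [gr gi]; split; rewrite ?cReD ?cImD.
  rewrite (_ : quotient _ _ = quotient (RePart f) x \+ quotient (RePart g) x).
    exact: cvgD.
  by apply/funext => y; rewrite /quotient /RePart /= !cReD -mulrDl addrACA -opprD.
rewrite (_ : quotient _ _ = quotient (ImPart f) x \+ quotient (ImPart g) x).
  exact: cvgD.
by apply/funext => y; rewrite /quotient /ImPart /= !cImD -mulrDl addrACA -opprD.
Qed.

Lemma has_deriv_in_sum D (I : Type) (r : seq I) (F : I -> R -> R[i]) (L : I -> R[i]) x :
  (forall i, has_deriv_in D (F i) x (L i)) ->
  has_deriv_in D (fun y => \sum_(i <- r) F i y) x (\sum_(i <- r) L i).
Proof.
move=> h; elim: r => [|i r IH].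
  by under eq_fun do rewrite big_nil; rewrite big_nil; exact: has_deriv_in_cst.
under eq_fun do rewrite big_cons; rewrite big_cons; exact: has_deriv_inD.
Qed.

Lemma eq_has_deriv_in D f g x l : D x -> (forall y, D y -> f y = g y) ->
  has_deriv_in D f x l -> has_deriv_in D g x l.
Proof.
move=> Dx fg [fr fi]; split.
  apply: cvg_trans fr; apply: near_eq_cvg; near=> y.
  have Dy : D y by near: y; exact: withinT.
  by rewrite /quotient /RePart /= (fg y)// (fg x).
apply: cvg_trans fi; apply: near_eq_cvg; near=> y.
have Dy : D y by near: y; exact: withinT.
by rewrite /quotient /ImPart /= (fg y)// (fg x).
Unshelve. all: by end_near. Qed.

Lemma is_derive_quotient_cvg D (p : R -> R) x d : is_derive x (1 : R) p d ->
  quotient p x @ within D x^' --> d.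
Proof.
move=> [dp dpE]; apply: cvg_within_filter.
have hc : (fun h => h^-1 *: ((p \o shift x) (h *: 1) - p x)) @ 0^' --> d.
  by rewrite -dpE.
apply/cvgrPdist_lt => e e0.
have /cvgrPdist_lt /(_ e e0) /nbhs_ballP[r /= r0 hr] := hc.
apply/nbhs_ballP; exists r => //= y xy yx.
have := hr (y - x); rewrite -ball_normE /= sub0r normrN distrC => /(_ xy).
rewrite subr_eq0 => /(_ yx); rewrite /GRing.scale /= mulr1 subrK.
by rewrite mulrC.
Qed.

Lemma has_deriv_in_expi D c n x :
  has_deriv_in D (fun y => c * expi n y) x (n%:~R * 'i * c * expi n x).
Proof.
split; apply: is_derive_quotient_cvg.
  exact: is_derive_Re_expi.
exact: is_derive_Im_expi.
Qed.

(** A convergent quotient is bounded near x, here by the absolute value of its limit plus 1, in each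
    component. *)
Lemma derivable_in_lipschitz D f x : derivable_in D f x ->
  exists M : R, 0 <= M /\
    \forall y \near x, D y -> normc (f y - f x) <= M * `|y - x|.
Proof.
have loc (q : R -> R) : cvg (quotient q x @ within D x^') ->
    exists M : R, 0 <= M /\ \forall y \near x, D y -> `|q y - q x| <= M * `|y - x|.
  move=> /cvg_ex[l hl]; exists (`|l| + 1); split; first by rewrite addr_ge0.
  have /cvgrPdist_lt /(_ 1 ltr01) := hl.
  rewrite /within /= => /nbhs_ballP[r /= r0 hr].
  apply/nbhs_ballP; exists r => //= y xy Dy.
  have [->|yx] := eqVneq y x; first by rewrite !subrr normr0 mulr0.
  have := hr y xy yx Dy; rewrite /quotient => h.
  rewrite -ler_pdivrMr ?normr_gt0 ?subr_eq0// -normfV -normrM.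
  rewrite -[X in `|X|](subKr l) (le_trans (ler_normB _ _))// lerD2l.
  exact: ltW.
move=> [/loc[M1 [M10 h1]] /loc[M2 [M20 h2]]].
exists (M1 + M2); split; first by rewrite addr_ge0.
near=> y => Dy; apply: le_trans (normc_le_Re_Im _) _.
rewrite mulrDl cReD cReN cImD cImN; apply: lerD.
  by move: Dy; near: y; exact: h1.
by move: Dy; near: y; exact: h2.
Unshelve. all: by end_near. Qed.

(** Turns closeness of increments, uniform in y, into closeness of derivatives. *)
Lemma lim_quotient_approx D (f p : R -> R) x l d e : ProperFilter (within D x^') ->
  quotient f x @ within D x^' --> l -> quotient p x @ within D x^' --> d ->
  (forall y, D y -> `|f y - f x - (p y - p x)| <= e * `|y - x|) -> `|l - d| <= e.
Proof.
move=> pf fl pd h.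
have hc : (fun y => `|quotient f x y - quotient p x y|) @ within D x^' --> `|l - d|.
  by apply: cvg_norm; exact: cvgB.
apply: (cvgr_to_le hc); near=> y.
have Dy : D y by near: y; exact: withinT.
have yx : y != x.
  by near: y; rewrite /within /=; apply: filterS (nbhs_dnbhs_neq x) => z.
rewrite /quotient -mulrBl normrM normfV ler_pdivrMr ?normr_gt0 ?subr_eq0//.
exact: h.
Unshelve. all: by end_near. Qed.

End one_sided_derivatives.

(** * Difference quotients of a periodic function, with denominator e^{it} - 1 *)

Section fourier_convergence.
Variable R : realType.
Implicit Types (v g : R -> R[i]).

Notation D := (`]0, 2 * pi[%classic : set R).
Notation J := (`[0, 2 * pi]%classic : set R).

(** Half angles: cos t = 1 - 2 sin^2 (t/2), and sin is positive at |t|/2 when 0 < |t| < 2 pi. *)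
Lemma cos_eq1 (t : R) : `|t| <= 2 * pi -> cos t = 1 -> t = 0 \/ `|t| = 2 * pi.
Proof.
move=> t2 ct; have ca : cos `|t| = 1 by rewrite cos_norm.
have [->|t0] := eqVneq t 0; first by left.
right; apply/eqP; rewrite eq_le t2 leNgt; apply/negP => tlt.
have h0 : 0 < `|t| / 2 by rewrite divr_gt0 ?normr_gt0.
have h1 : 0 < sin (`|t| / 2).
  by apply: sin_gt0_pi; rewrite h0 ltr_pdivrMr// mulrC.
have : cos (`|t| / 2 *+ 2) = 1 by rewrite -mulr_natr divfK.
rewrite cos_mulr2n cos2sin2 => h2.
have : sin (`|t| / 2) ^+ 2 = 0 by move: h2; rewrite mulrnBl; lra.
by move/eqP; rewrite expf_eq0 /= gt_eqF.
Qed.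

(** The mean value theorem for the sine, whose derivative is at least cos 1 on [-1, 1]. *)
Lemma normc_expi1B (t : R) : `|t| <= 1 -> cos 1 * `|t| <= normc (expi 1 t - 1).
Proof.
move=> t1; apply: (le_trans _ (normc_Im _)); rewrite cImD cImN /= subr0 mul1r.
have cs (a b : R) : {within `[a, b], continuous (@sin R)}.
  by apply: continuous_subspaceT => z; exact: continuous_sin.
have cosge (c : R) : `|c| <= 1 -> cos 1 <= cos c.
  move=> c1; rewrite -[leRHS]cos_norm le_eqVlt.
  have pi1 : (1 : R) <= pi by rewrite (le_trans _ (pi_ge2 R))// ler1n.
  have [->|cn1] := eqVneq `|c| 1; first by rewrite eqxx.
  rewrite ltr_cos ?in_itv/= ?ler01 ?normr_ge0 ?(le_trans c1)//.
  by rewrite lt_neqAle cn1 c1 orbT.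
have main (a b : R) : a <= b -> (forall c, c \in `[a, b] -> `|c| <= 1) ->
    cos 1 * `|b - a| <= `|sin b - sin a|.
  move=> ab h; have [c cab ->] := MVT_segment ab (fun x _ => is_derive_sin x) (cs a b).
  rewrite normrM ler_wpM2r//; apply: le_trans (ler_norm _).
  exact/cosge/h.
have [t0|t0] := leP 0 t.
  have := main 0 t t0; rewrite sin0 !subr0; apply => c.
  rewrite in_itv/= => /andP[c0 ct]; rewrite ger0_norm// (le_trans ct)//.
  by rewrite ger0_norm in t1.
have := main t 0 (ltW t0); rewrite sin0 !sub0r !normrN; apply => c.
rewrite in_itv/= => /andP[c0 ct]; rewrite ler0_norm//.
by rewrite ltr0_norm// in t1; rewrite (le_trans _ t1)// lerN2.
Qed.

Lemma sqr_normc_expi1B (t : R) : normc (expi 1 t - 1) ^+ 2 = 2 - 2 * cos t.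
Proof.
rewrite sqr_normc2 cReD cImD cReN cImN /= mul1r.
by rewrite subr0 sqrrD sin2cos2; ring.
Qed.

(** By compactness of the period a bound near each point y suffices. Where e^{i(y - x0)} = 1, the
    Lipschitz bound of v at y is compared with the linear lower bound of the denominator; elsewhere
    the denominator stays away from 0. *)
Lemma difference_quotient_bounded v x0 :
  (forall x, x \in J -> derivable_in J v x) -> v 0 = v (2 * pi) -> x0 \in J ->
  exists M : R, forall x, J x ->
    normc (v x - v x0) <= M * normc (expi 1 (x - x0) - 1).
Proof.
move=> dv vper x0J.
have near_dist (y r : R) : 0 < r -> \forall x \near y, `|y - x| <= r.
  by move=> r0; apply/nbhs_ballP; exists r => //= x; rewrite -ball_normE => /ltW.
pose psi x := normc (expi 1 (x - x0) - 1).
have loc y : J y -> exists M, \forall x \near y, J x -> normc (v x - v x0) <= M * psi x.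
  move=> Jy; have [C [C0 hC]] : exists M : R, 0 <= M /\
    \forall x \near y, J x -> normc (v x - v y) <= M * `|x - y|.
    by apply: derivable_in_lipschitz; apply: dv; exact/mem_set.
  (* The denominator vanishes at y = x0, and also when y and x0 are opposite end points; in the
     latter case [vper] gives v y = v x0. *)
  have [psi0|psi0] := eqVneq (psi y) 0.
    have e1 : expi 1 (y - x0) = 1.
      by apply/eqP; rewrite -subr_eq0; apply/eqP/Normc.eq0_normc.
    have vy : v y = v x0.
      move: Jy x0J; rewrite inE /= !in_itv /= => /andP[y0 y1] /andP[z0 z1].
      have := @cos_eq1 (y - x0); rewrite (_ : cos _ = 1); last first.
        by move: e1 => /(congr1 (@complex.Re R)) /=; rewrite mul1r.
      have yz : `|y - x0| <= 2 * pi.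
        by rewrite ler_norml; apply/andP; split; lra.
      move=> /(_ yz erefl)[/subr0_eq->//|].
      have [yx|yx] := leP x0 y;
        [rewrite ger0_norm ?subr_ge0//|rewrite ltr0_norm ?subr_lt0//] => h.
        have -> : y = 2 * pi by apply/eqP; rewrite eq_le y1; lra.
        by have -> : x0 = 0 by apply/eqP; rewrite eq_le z0 andbT; lra.
      have -> : y = 0 by apply/eqP; rewrite eq_le y0 andbT; lra.
      by have -> : x0 = 2 * pi by apply/eqP; rewrite eq_le z1; lra.
    exists (C / cos 1); near=> x => Jx; rewrite -vy.
    apply: (@le_trans _ _ (C * `|x - y|)); first by move: Jx; near: x.
    rewrite -mulrA ler_wpM2l// ler_pdivlMl ?cos1_gt0//.
    rewrite /psi (_ : x - x0 = (x - y) + (y - x0)); last by rewrite addrA subrK.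
    rewrite expiDr e1 mulr1.
    by apply: normc_expi1B; rewrite distrC; near: x; exact: near_dist.
  have psig : 0 < psi y by rewrite lt_neqAle eq_sym psi0 normc_ge0.
  exists ((normc (v y - v x0) + C) / (psi y / 2)); near=> x => Jx.
  have x1 : `|y - x| <= 1 by near: x; exact: near_dist.
  have hpsi : psi y / 2 <= psi x.
    have : psi y <= psi x + normc (expi 1 (y - x0) - expi 1 (x - x0)).
      rewrite /psi -[X in normc X <= _](subrK (expi 1 (x - x0) - 1)) addrC.
      by apply: le_trans (le_normcD _ _) _; rewrite lerD2l opprB addrA subrK.
    have := normc_expiB 1 (x - x0) (y - x0).
    rewrite opprB addrA subrK normr1 mulr1.
    (* With the Lipschitz constant 2 of the exponential, [psi] drops by at most half of [psi y]. *)
    have : `|y - x| <= psi y / 4 by near: x; apply: near_dist; rewrite divr_gt0.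
    lra.
  apply: (@le_trans _ _ (normc (v y - v x0) + C)).
    rewrite (_ : v x - v x0 = (v y - v x0) + (v x - v y)); last by ring.
    apply: le_trans (le_normcD _ _) _; rewrite lerD2l.
    apply: (@le_trans _ _ (C * `|x - y|)); first by move: Jx; near: x.
    by rewrite distrC ler_piMr.
  rewrite -mulrA ler_peMr ?addr_ge0 ?normc_ge0//.
  by rewrite ler_pdivlMl ?divr_gt0// mulr1.
(* The bound M is the parameter of the covering and tends to infinity: every local estimate remains
   true for larger M. *)
have /compact_near_coveringP/near_covering_withinP cov := @segment_compact R 0 (2 * pi).
have := cov R (pinfty_nbhs R) (fun M x => normc (v x - v x0) <= M * psi x) _.
case.
  move=> y Jy; have [M hM] := loc y Jy.
  exists ([set x | J x -> normc (v x - v x0) <= M * psi x], [set N | M <= N]) => /=.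
    split; first exact: hM.
    by apply: nbhs_pinfty_ge; exact: num_real.
  move=> [x N] [/= hx MN] Jx; apply: le_trans (hx Jx) _.
  by rewrite ler_wpM2r// normc_ge0.
move=> M [_ hM]; exists (M + 1) => x Jx; apply: hM => //; by rewrite ltrDl.
Unshelve. all: by end_near. Qed.

End fourier_convergence.

(** * Pointwise convergence of Fourier series *)

Section fourier_series.
Variable R : realType.
Implicit Types (v g : R -> R[i]) (a : int -> R[i]).

Notation D := (`]0, 2 * pi[%classic : set R).
Notation J := (`[0, 2 * pi]%classic : set R).

Lemma cintegral_eq_in v g : (forall x, D x -> v x = g x) ->
  cintegral v = cintegral g.
Proof.
move=> vg; rewrite /cintegral; congr (_ +i* _); apply: eq_Rintegral => x /set_mem Dx.
  by rewrite /RePart vg.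
by rewrite /ImPart vg.
Qed.

Lemma measurable_inv_sqr_normc (x0 : R) :
  measurable_fun D (fun x => (2 - 2 * cos (x - x0))^-1).
Proof.
(* The inverse is a power with exponent -1, which is measurable; the two agree because 2 - 2 cos is
   nonnegative. *)
rewrite (_ : (fun x => _) = (@powR R ^~ (-1)) \o (fun x => 2 - 2 * cos (x - x0))).
  apply: measurableT_comp; first exact: measurable_powR.
  apply: measurable_funB => //; apply: measurable_funM => //.
  apply: measurable_funTS; apply: continuous_measurable_fun => x.
  apply: continuous_comp; last exact: continuous_cos.
  by apply: cvgB; [exact: cvg_id|exact: cvg_cst].
by apply/funext => x /=; rewrite powR_inv1// -sqr_normc_expi1B sqr_ge0.
Qed.

Lemma measurable_RePartM v g :
  measurable_fun D (RePart v) -> measurable_fun D (ImPart v) ->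
  measurable_fun D (RePart g) -> measurable_fun D (ImPart g) ->
  measurable_fun D (RePart (fun x => v x * g x)) /\
  measurable_fun D (ImPart (fun x => v x * g x)).
Proof.
move=> vr vi gr gi; split.
  rewrite (_ : RePart _ = (RePart v \* RePart g) \- (ImPart v \* ImPart g)).
    by apply: measurable_funB; apply: measurable_funM.
  by apply/funext => x; rewrite /RePart cReM.
rewrite (_ : ImPart _ = (RePart v \* ImPart g) \+ (ImPart v \* RePart g)).
  by apply: measurable_funD; apply: measurable_funM.
by apply/funext => x; rewrite /ImPart cImM.
Qed.

(** The quotient is bounded, hence square integrable. At a zero of the denominator the bound forces
    v x = v x0, so the value 0 taken there by g is consistent. *)
Lemma L2_difference_quotient v x0 : L2 v ->
  (forall x, x \in J -> derivable_in J v x) -> v 0 = v (2 * pi) -> x0 \in J ->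
  exists2 g, L2 g & forall x, J x -> v x - v x0 = g x * (expi 1 (x - x0) - 1).
Proof.
move=> L2v dv vper x0J.
have [M hM] := difference_quotient_bounded dv vper x0J.
pose w x : R[i] := expi 1 (x - x0) - 1.
(* Division by w as multiplication by its conjugate over |w|^2 = 2 - 2 cos, which makes
   measurability visible. *)
pose g x : R[i] := (v x - v x0) * (conjc (w x) * ((2 - 2 * cos (x - x0))^-1)%:C).
have gw x : g x = (v x - v x0) * (w x)^-1.
  rewrite /g; congr (_ * _); have [w0|w0] := eqVneq (w x) 0.
    by rewrite w0 rmorph0 mul0r invr0.
  apply: (mulfI w0); rewrite mulfV// mulrA -sqr_normcJ -sqr_normc_expi1B -rmorphM.
  rewrite mulfV// expf_eq0; apply/negP => /andP[_ /eqP h0].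
  have h := Normc.eq0_normc h0.
  by move/eqP: w0; apply; exact: h.
exists g; last first.
  move=> x Jx; rewrite gw; have [w0|w0] := eqVneq (w x) 0; last by rewrite divfK.
  have := hM x Jx; rewrite -/(w x) w0 Normc.normc0 mulr0 => h.
  rewrite mulr0; apply: Normc.eq0_normc; apply/eqP; rewrite eq_le h; exact: normc_ge0.
have [vr vi _] : L2 (fun x => v x - v x0).
  have := L2D L2v (L2_cst (- v x0)); exact.
have [wr wi _] : L2 (fun x => conjc (w x)).
  apply: L2_conj; have := L2D (L2Z (expi 1 (- x0)) (L2_expi _ 1)) (L2_cst (-1)).
  congr L2; apply/funext => x; by rewrite /w expiDr mulrC.
have [ir ii] := measurable_RePartM wr wi
  (g := fun x => ((2 - 2 * cos (x - x0))^-1)%:C) (measurable_inv_sqr_normc x0)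
  (@measurable_cst _ _ _ _ _ (0 : R)).
have [gr gi] := measurable_RePartM vr vi ir ii.
apply: (L2_bounded (f := g) (M := `|M|) gr gi) => x Dx.
have Jx : J x by apply: subset_itv_oo_cc.
rewrite gw Normc.normcM Normc.normcV.
have [w0|w0] := eqVneq (normc (w x)) 0; first by rewrite w0 invr0 mulr0.
rewrite ler_pdivrMr; last by rewrite lt_neqAle eq_sym w0 normc_ge0.
apply: le_trans (hM x Jx) _; rewrite ler_wpM2r ?normc_ge0//; exact: ler_norm.
Qed.

(* g is the quotient (v - v x0) / (e^{i(. - x0)} - 1); its Fourier
   coefficients make the partial sums of v - v x0 telescope *)
Theorem fourier_cvg v x0 : L2 v ->
  (forall x, x \in J -> derivable_in J v x) -> v 0 = v (2 * pi) -> x0 \in J ->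
  ccvg (fun K => ssum K (fun n => fcoef v n * expi n x0)) (v x0).
Proof.
move=> L2v dv vper x0J.
have [g L2g vg] := L2_difference_quotient L2v dv vper x0J.
pose h n : R[i] := fcoef g n * expi n x0.
have nh n : normc (h n) = normc (fcoef g n) by rewrite Normc.normcM normc_expi mulr1.
(* The Fourier coefficients of the constant v x0. *)
pose d (n : int) : R[i] := if n == 0 then v x0 else 0.
have coefE n : fcoef v n * expi n x0 = d n + (h (n - 1) - h n).
  (* Multiplication of g by e^{i(x - x0)} shifts its coefficients by one index. *)
  have -> : fcoef v n = d n + expi 1 (- x0) * fcoef g (n - 1) - fcoef g n.
    rewrite /fcoef (@cintegral_eq_in _ (fun x => (v x0 * expi (- n) x +
        expi 1 (- x0) * (g x * expi (- (n - 1)) x)) + -1 * (g x * expi (- n) x))); last first.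
      move=> x Dx; have Jx : J x by apply: subset_itv_oo_cc.
      rewrite -[v x](subrK (v x0)) vg// expiDr opprB [1 - n]addrC expiD; ring.
    have gi m : cintegrable (fun x => g x * expi m x) by exact: L2_cintegrableM L2g (L2_expi _ _).
    have ei m : cintegrable (@expi R m) by exact/L2_cintegrable/L2_expi.
    rewrite cintegralD; last 2 first.
    - by apply: cintegrableD; exact: cintegrableZ.
    - exact: cintegrableZ.
    rewrite cintegralD; last 2 first.
    - exact: cintegrableZ.
    - exact: cintegrableZ.
    rewrite !cintegralZ// cintegral_expi oppr_eq0 /d.
    have := two_pi_neq0 R; move: (2 * pi)%:C => c c0.
    by case: eqVneq => _; field.
  have dx : d n * expi n x0 = d n.
    by rewrite /d; case: eqVneq => [->|_]; rewrite ?expi0 ?mulr1 ?mul0r.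
  have ee : expi 1 (- x0) * expi n x0 = expi (n - 1) x0.
    by rewrite addrC expiD /expi !mulrN mulrNz !mulNr.
  by rewrite /h -ee mulrBl mulrDl dx; ring.
(* The window for K = 0 is empty and misses the frequency 0, hence the successor. *)
have sumd K : ssum K.+1 d = v x0.
  elim: K => [|K IH]; rewrite ssumS; first by rewrite ssum0 addr0 add0r.
  by rewrite IH [d _]/d [d _]/d /= add0r addr0.
have [c1 c2] := fcoef_cvg0 L2g.
apply: (@ccvg_dist _ _ _ (fun K => normc (fcoef g (- K.+1%:Z)) +
  normc (fcoef g (K%:Z - 1)))); last first.
  rewrite -[X in _ --> X]addr0; apply: cvgD => //.
  rewrite -cvg_shiftS; apply: cvg_trans c1; apply: near_eq_cvg; apply: nearW => K /=.
  by congr (normc (fcoef g _)); lia.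
exists 1%N => // -[//|K] _ /=.
rewrite (_ : ssum K.+1 _ = v x0 + (h (- K.+1%:Z - 1) - h (K.+1%:Z - 1))); last first.
  rewrite -ssum_telescope -(sumd K) /ssum -big_split/=; apply: eq_bigr => i _.
  exact: coefE.
rewrite addrC addKr; apply: le_trans (le_normcD _ _) _.
rewrite normcN !nh.
have -> : - K.+1%:Z - 1 = - K.+2%:Z by lia.
exact: lexx.
Qed.

(** The increments of the tail between x and y are at most e K |y - x|, with e K twice the tail of
    sum |n| |a n|. Hence the derivative of f, which is assumed to exist, differs from that of the
    K-th partial sum by at most e K in each component. *)
Theorem termwise_deriv a (f : R -> R[i]) (B : R) x : x \in J -> derivable_in J f x ->
  (forall K, ssum K (fun n => `|n%:~R| * normc (a n)) <= B) ->
  (forall y, J y -> ccvg (fun K => ssum K (fun n => a n * expi n y)) (f y)) ->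
  ccvg (fun K => ssum K (fun n => n%:~R * 'i * a n * expi n x)) (dx f x).
Proof.
move=> xJ df aB cf; have Jx : J x by exact: set_mem.
pose S K y : R[i] := ssum K (fun n => a n * expi n y).
pose b n := `|n%:~R : R| * normc (a n).
have b0 n : 0 <= b n by rewrite mulr_ge0 ?normc_ge0.
have cb : cvgn (fun K => ssum K b) by apply: (ssum_is_cvgn (B := B)).
have nb := ssum_nondecreasing b0.
pose T := limn (fun K => ssum K b).
have bT K : ssum K b <= T by exact: (nondecreasing_cvgn_le nb cb).
pose e K := 2 * (T - ssum K b).
have block y K d : normc (S (K + d)%N y - S (K + d)%N x - (S K y - S K x)) <=
    2 * (ssum (K + d) b - ssum K b) * `|y - x|.
  elim: d => [|d IH]; first by rewrite addn0 !subrr Normc.normc0 mulr0 mul0r.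
  have tm n : normc (a n * (expi n y - expi n x)) <= 2 * b n * `|y - x|.
    rewrite Normc.normcM; apply: le_trans (ler_wpM2l (normc_ge0 _) (normc_expiB _ _ _)) _.
    by rewrite /b le_eqVlt; apply/orP; left; apply/eqP; ring.
  rewrite addnS /S !ssumS -!/(S _ _); set L := (K + d)%N in IH *.
  rewrite (_ : _ - _ = (S L y - S L x - (S K y - S K x)) +
    a (- L.+1%:Z) * (expi (- L.+1%:Z) y - expi (- L.+1%:Z) x) +
    a L * (expi L y - expi L x)); last by ring.
  apply: le_trans (le_normcD _ _) _.
  apply: le_trans (lerD (le_normcD _ _) (lexx _)) _.
  apply: le_trans (lerD (lerD IH (tm _)) (tm _)) _.
  by rewrite le_eqVlt; apply/orP; left; apply/eqP; ring.
(* [block] as the longer window grows; squares are compared because the squared modulus is what is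
   known to converge. *)
have approx y K : J y -> normc (f y - f x - (S K y - S K x)) <= e K * `|y - x|.
  move=> Jy; rewrite -(ler_pXn2r (n:=2)) ?nnegrE ?normc_ge0//; last first.
    by rewrite mulr_ge0 ?normr_ge0// mulr_ge0// subr_ge0.
  have cS : ccvg (fun L => S L y - S L x - (S K y - S K x)) (f y - f x - (S K y - S K x)).
    by apply: ccvgB; [apply: ccvgB; exact: cf|exact: ccvg_cst].
  apply: (cvgr_to_le (ccvg_sqr_normc cS)); exists K => // L /= KL.
  rewrite lerXn2r ?nnegrE ?normc_ge0//.
    by rewrite mulr_ge0 ?normr_ge0// mulr_ge0// subr_ge0.
  rewrite -(subnKC KL); apply: le_trans (block _ _ _) _.
  by rewrite ler_wpM2r// ler_wpM2l// lerB.
have pi2 : (0 : R) < 2 * pi by rewrite mulr_gt0 ?pi_gt0.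
have pf : ProperFilter (within J x^') by exact: within_itv_proper.
have [hr hi] := derivable_in_has df.
have sd K : has_deriv_in J (S K) x (ssum K (fun n => n%:~R * 'i * a n * expi n x)).
  by apply: has_deriv_in_sum => j; exact: has_deriv_in_expi.
(* One e K for each component. *)
apply: (@ccvg_dist _ _ _ (fun K => e K + e K)); last first.
  rewrite -[X in _ --> X]addr0.
  have e0 : e @ \oo --> (0 : R).
    rewrite /e -[X in _ --> X](mulr0 2) -[X in _ * X](subrr T).
    by apply: cvgM; [exact: cvg_cst|apply: cvgB => //; exact: cvg_cst].
  exact: cvgD.
apply: nearW => K.
have [sr si] := sd K.
rewrite -normcN opprB; apply: le_trans (normc_le_Re_Im _) _.
rewrite !(cReD, cImD, cReN, cImN); apply: lerD.
  apply: (lim_quotient_approx pf hr sr) => y Jy.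
  apply: le_trans (approx y K Jy).
  by have := normc_Re (f y - f x - (S K y - S K x)); rewrite !(cReD, cReN).
apply: (lim_quotient_approx pf hi si) => y Jy.
apply: le_trans (approx y K Jy).
by have := normc_Im (f y - f x - (S K y - S K x)); rewrite !(cImD, cImN).
Qed.

End fourier_series.

(** * Discrete Fourier transform *)

Section discrete_fourier.
Variables (R : realType) (N : nat).
Hypothesis N_gt0 : (0 < N)%N.
Implicit Types (m n : int) (c : 'I_(2 * N) -> R[i]) (u : R -> R[i]).

Notation J := (`[0, 2 * pi]%classic : set R).
Notation node := (@node R N).
Notation theta := (pi / N%:R : R).

Let N_neq0 : N%:R != 0 :> R. Proof. by rewrite pnatr_eq0 -lt0n. Qed.

(** Moves the node index into the frequency, so that sums over nodes and sums over frequencies both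
    become geometric sums in e^{im theta}. *)
Lemma expi_node n (j : nat) : expi n (node j) = expi (n * j) theta.
Proof. by rewrite /expi /node intrM -!mulrA. Qed.

Lemma node_in (j : 'I_(2 * N)) : node j \in J.
Proof.
apply/mem_set; rewrite /= in_itv /= /node divr_ge0 ?mulr_ge0 ?pi_ge0 ?ler0n//=.
rewrite ler_pdivrMr ?ltr0n// mulrAC ler_wpM2r ?pi_ge0//.
by rewrite -natrM ler_nat ltnW.
Qed.

Lemma expi_node_period n (j : nat) : expi ((2 * N)%:Z * n) (node j) = 1.
Proof.
rewrite -[RHS](expi_period R (n * j)) /expi /node !intrM.
have -> : ((2 * N)%:Z%:~R : R) = 2 * N%:R by rewrite -natrM.
have -> : 2 * N%:R * n%:~R * (j%:R * pi / N%:R) = n%:~R * j%:~R * (2 * pi) :> R by field.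
by [].
Qed.

Lemma expi_shift m n (j : nat) : expi (m + (2 * N)%:Z * n) (node j) = expi m (node j).
Proof. by rewrite expiD expi_node_period mulr1. Qed.

Lemma expi_theta_pow m (k : nat) : expi (m * k) theta = expi m theta ^+ k.
Proof.
elim: k => [|k IH]; first by rewrite mulr0 expi0.
by rewrite exprS -IH -expiD; congr expi; lia.
Qed.

(** For m <> 0 the ratio is not 1, as 0 < |m theta| < 2 pi, while its power 2N is 1. *)
Lemma sum_expi_theta m : `|m| < (2 * N)%:Z ->
  \sum_(j < 2 * N) expi m theta ^+ j = if m == 0 then (2 * N)%:R else 0.
Proof.
move=> mN; case: eqVneq => [->|m0].
  under eq_bigr do rewrite expi0 expr1n.
  by rewrite sumr_const card_ord.
have w1 : expi m theta - 1 != 0.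
  rewrite subr_eq0; apply/eqP => /(congr1 (@complex.Re R)) /=.
  move=> /cos_eq1; have tpi : `|m%:~R * theta| < 2 * pi.
    rewrite normrM (ger0_norm (x := theta)) ?divr_ge0 ?pi_ge0//.
    rewrite mulrA ltr_pdivrMr ?ltr0n// mulrAC ltr_pM2r ?pi_gt0//.
    by rewrite -natrM -intr_norm -[ltRHS]/((2 * N)%:Z%:~R) ltr_int.
  case; first exact: ltW.
    move/eqP; rewrite !mulf_eq0 invr_eq0 (negbTE N_neq0) intr_eq0 (negbTE m0).
    by rewrite gt_eqF ?pi_gt0.
  by move=> h; move: tpi; rewrite h ltxx.
apply: (mulfI w1); rewrite mulr0 -subrX1.
have -> : expi m theta ^+ (2 * N) = 1; last by rewrite subrr.
by rewrite -expi_theta_pow mulrC -[RHS](expi_node_period m 1) expi_node mulr1.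
Qed.

Lemma dft_trig_sum c (k : 'I_(2 * N)) : dft N (trig_sum c) (freq N k) = c k.
Proof.
rewrite /dft /trig_sum.
under eq_bigr do rewrite mulr_suml.
rewrite exchange_big /= (bigD1 k)//= [X in _ + X]big1 ?addr0; last first.
  move=> i ik.
  under eq_bigr do rewrite -mulrA -expiD expi_node expi_theta_pow.
  rewrite -mulr_sumr sum_expi_theta; last first.
    by have := ltn_ord i; have := ltn_ord k; rewrite /freq; lia.
  by rewrite subr_eq0 freq_inj (negbTE ik) mulr0.
under eq_bigr do rewrite -mulrA -expiD subrr expi0 mulr1.
rewrite sumr_const card_ord -[c k *+ _]mulr_natl mulKf// pnatr_eq0.
by lia.
Qed.

Lemma interp_node u (j : 'I_(2 * N)) : interp N u (node j) = u (node j).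
Proof.
rewrite /interp /trig_sum /dft.
under eq_bigr do rewrite -mulrA mulr_suml.
rewrite -mulr_sumr exchange_big /= (bigD1 j)//= [X in _ + X]big1 ?addr0; last first.
  move=> i ij; under eq_bigr => k _.
    rewrite -mulrA !expi_node -expiD.
    (* The offset -N of the frequencies is split off as a factor that does not depend on k. *)
    rewrite (_ : _ + _ = - (N%:Z * (j%:Z - i%:Z)) + (j%:Z - i%:Z) * k%:Z); last first.
      by rewrite /freq; ring.
    rewrite expiD expi_theta_pow mulrA.
    over.
  rewrite -mulr_sumr sum_expi_theta; last by have := ltn_ord i; have := ltn_ord j; lia.
  rewrite subr_eq0 eqz_nat; case: eqVneq => [/val_inj h|_]; last by rewrite mulr0.
  by rewrite h eqxx in ij.
under eq_bigr do rewrite -mulrA -expiD addNr expi0 mulr1.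
rewrite sumr_const card_ord -[u _ *+ _]mulr_natl mulKf// pnatr_eq0.
by lia.
Qed.

Lemma conj_trig_sum c x :
  conjc (trig_sum c x) = \sum_(k < 2 * N) conjc (c k) * expi (- freq N k) x.
Proof.
rewrite /trig_sum rmorph_sum; apply: eq_bigr => k _; rewrite expiN; exact: conjM.
Qed.

Lemma discrete_parseval c :
  \sum_(j < 2 * N) normc (trig_sum c (node j)) ^+ 2 =
  (2 * N)%:R * \sum_(k < 2 * N) normc (c k) ^+ 2.
Proof.
apply: complexI; rewrite rmorphM !rmorph_sum /= rmorph_nat.
under eq_bigr => j _.
  rewrite sqr_normcJ conj_trig_sum mulr_sumr.
  under eq_bigr do rewrite mulrCA.
  over.
rewrite exchange_big /= mulr_sumr; apply: eq_bigr => k _.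
(* The inner sum over the nodes is, up to the factor 2N, the discrete coefficient of the
   trigonometric sum, namely c k. *)
rewrite -mulr_sumr sqr_normcJ -[X in _ = _ * (X * _)](dft_trig_sum c k) /dft.
set S := \sum_(_ < _) _; have N2 : (2 * N)%:R != 0 :> R[i] by rewrite pnatr_eq0; lia.
by move: N2; move: ((2 * N)%:R : R[i]) => q q0; field.
Qed.

Lemma sqnorm_trig_sum c :
  sqnorm (trig_sum c) = 2 * pi * \sum_(k < 2 * N) normc (c k) ^+ 2 /\
  L2 (trig_sum c).
Proof.
(* Extends the coefficients to all integers, by 0 outside the frequency range. *)
pose a n := \sum_(k < 2 * N | freq N k == n) c k.
have aE (k : 'I_(2 * N)) : a (freq N k) = c k.
  by rewrite /a (big_pred1 k)// => i; rewrite /= freq_inj.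
have -> : trig_sum c = fun x => ssum N (fun n => a n * expi n x).
  by apply/funext => x; apply: eq_bigr => k _; rewrite aE.
split; last exact: L2_ssum.
by rewrite sqnorm_ssum /ssum; under eq_bigr do rewrite aE.
Qed.

Lemma L2norm_S_ F : S_ N F ->
  L2norm F = (Num.sqrt (pi / N%:R * \sum_(j < 2 * N) normc (F (node j)) ^+ 2))%:E.
Proof.
move=> [c _ <-]; have [sq L2c] := sqnorm_trig_sum c.
rewrite L2norm_sqnorm// sq discrete_parseval natrM.
by congr ((Num.sqrt _)%:E); field.
Qed.

Lemma has_deriv_in_trig_sum D c x :
  has_deriv_in D (trig_sum c) x (trig_sum (fun k => (freq N k)%:~R * 'i * c k) x).
Proof. by apply: has_deriv_in_sum => k; exact: has_deriv_in_expi. Qed.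

Lemma period_proper (x : R) : x \in J -> ProperFilter (within J x^').
Proof.
move=> /set_mem xJ; apply: within_itv_proper => //.
by rewrite mulr_gt0 ?pi_gt0.
Qed.

Lemma dx_trig_sum c x : x \in J ->
  dx (trig_sum c) x = trig_sum (fun k => (freq N k)%:~R * 'i * c k) x.
Proof.
move=> xJ; apply: has_deriv_inE; first exact: period_proper.
exact: has_deriv_in_trig_sum.
Qed.

Lemma dxx_trig_sum c x : x \in J -> dx (dx (trig_sum c)) x =
  trig_sum (fun k => (freq N k)%:~R * 'i * ((freq N k)%:~R * 'i * c k)) x.
Proof.
move=> xJ; apply: has_deriv_inE; first exact: period_proper.
apply: eq_has_deriv_in (has_deriv_in_trig_sum _ _ _); first exact: set_mem.
by move=> y Jy; rewrite dx_trig_sum//; exact: mem_set.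
Qed.

End discrete_fourier.

(** * Aliasing error *)

Section aliasing.
Variables (R : realType) (N s : nat) (c : int -> R[i]) (S0 : R).
Hypotheses (N_gt0 : (0 < N)%N) (s_gt0 : (0 < s)%N).
Hypothesis decay : forall K,
  ssum K (fun n => (`|n%:~R| ^+ s.+2 * normc (c n)) ^+ 2) <= S0.

Notation node := (@node R N).
Notation d := (fun n : int => `|n%:~R : R| ^+ s.+2 * normc (c n)).

(* the sum of f over the frequencies k + 2Nl, |l| <= L, which agree at the nodes *)
Definition alias (V : nmodType) (f : int -> V) L (k : int) : V :=
  f k + \sum_(l < L) (f (k + (2 * N * l.+1)%:Z) + f (k - (2 * N * l.+1)%:Z)).

Definition deriv_coef q (n : int) : R[i] := (n%:~R * 'i) ^+ q * c n.

Lemma ssum_node (f : int -> R[i]) L (j : nat) :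
  ssum (N * (2 * L + 1)) (fun n => f n * expi n (node j)) =
  trig_sum (fun k : 'I_(2 * N) => alias f L (freq N k)) (node j).
Proof.
rewrite ssum_tile; apply: eq_bigr => k _.
rewrite /alias mulrDl mulr_suml; congr (_ + _); apply: eq_bigr => l _.
have -> : (2 * N * l.+1)%:Z = (2 * N)%:Z * l.+1 by [].
rewrite -mulrN !expi_shift// -mulrDl//.
Qed.

(** As |k - N| <= N, an aliased frequency has modulus at least 2N(l+1) - N >= N(l+1) >= N. *)
Lemma freq_alias_le (k : 'I_(2 * N)) (l : nat) (n : int) :
  n = freq N k + (2 * N * l.+1)%:Z \/ n = freq N k - (2 * N * l.+1)%:Z ->
  `|(freq N k)%:~R| <= `|n%:~R| :> R /\ N%:R * l.+1%:R <= `|n%:~R| :> R.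
Proof.
have kN := ltn_ord k; have hl : (N <= N * l.+1)%N by rewrite leq_pmulr.
rewrite -mulnA => h; rewrite -!intr_norm -natrM -[(N * l.+1)%:R]/((N * l.+1)%:Z%:~R) !ler_int.
move: h; rewrite /freq; move: (N * l.+1)%N hl => P hl; lia.
Qed.

(** Trades |n|^-s for N^-s (l+1)^-s. As s >= 1, the last factor is at most (l+1)^-1, which is square
    summable; this prepares Cauchy-Schwarz in l. *)
Lemma sqr_coef_le (k : 'I_(2 * N)) (l : nat) (n : int) :
  n = freq N k + (2 * N * l.+1)%:Z \/ n = freq N k - (2 * N * l.+1)%:Z ->
  `|n%:~R| ^+ 2 * normc (c n) <= N%:R ^- s * (l.+1%:R^-1 * d n).
Proof.
move=> /freq_alias_le[_ h]; have N0 : (0 : R) < N%:R by rewrite ltr0n.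
rewrite mulrA -invfM ler_pdivlMl ?mulr_gt0 ?exprn_gt0//.
rewrite -(addn2 s) exprD -[leRHS]mulrA.
rewrite ler_wpM2r ?mulr_ge0 ?normc_ge0 ?sqr_ge0//.
have l1 : (1 : R) <= l.+1%:R by rewrite ler1n.
apply: (@le_trans _ _ ((N%:R * l.+1%:R) ^+ s)).
  by rewrite exprMn ler_wpM2l ?exprn_ge0// -[X in X <= _]expr1 ler_weXn2l.
by rewrite lerXn2r ?nnegrE ?mulr_ge0.
Qed.

(** A mode of frequency n aliased to m is differentiated with the factor n in the Fourier series but
    with m in the interpolant. *)
Lemma normc_deriv_coefB q (m n : int) : (q <= 2)%N ->
  `|m%:~R| <= `|n%:~R| :> R -> 1 <= `|n%:~R| :> R ->
  normc ((n%:~R * 'i) ^+ q * c n - (m%:~R * 'i) ^+ q * c n) <=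
  2 * (`|n%:~R| ^+ 2 * normc (c n)).
Proof.
move=> q2 mn n1; rewrite -mulrBl Normc.normcM mulrA ler_wpM2r ?normc_ge0//.
apply: le_trans (le_normcD _ _) _; rewrite normcN !normc_freqX mulr_natl mulr2n.
have nq : `|n%:~R : R| ^+ q <= `|n%:~R| ^+ 2 by rewrite ler_weXn2l.
by apply: lerD => //; apply: le_trans nq; rewrite lerXn2r ?nnegrE.
Qed.

(** Here 16 = 2^2 * 2 * 2: the factor 2 of each term squared, the bound 2 for the sum of (l+1)^-2,
    and (x + y)^2 <= 2 (x^2 + y^2) for the two signs. *)
Lemma alias_error_sqr q L (k : 'I_(2 * N)) : (q <= 2)%N ->
  normc (alias (deriv_coef q) L (freq N k) -
         ((freq N k)%:~R * 'i) ^+ q * alias c L (freq N k)) ^+ 2 <=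
  16 * (N%:R ^- s) ^+ 2 *
  \sum_(l < L) (d (freq N k + (2 * N * l.+1)%:Z) ^+ 2 +
                d (freq N k - (2 * N * l.+1)%:Z) ^+ 2).
Proof.
move=> q2; set m := freq N k.
have N0 : (0 : R) < N%:R by rewrite ltr0n.
have Ns : 0 <= N%:R ^- s :> R by rewrite invr_ge0 exprn_ge0.
pose e (l : nat) := d (m + (2 * N * l.+1)%:Z) + d (m - (2 * N * l.+1)%:Z).
have d0 n : 0 <= d n by rewrite mulr_ge0 ?normc_ge0 ?exprn_ge0.
have term l n : n = m + (2 * N * l.+1)%:Z \/ n = m - (2 * N * l.+1)%:Z ->
    normc (deriv_coef q n - (m%:~R * 'i) ^+ q * c n) <=
    2 * N%:R ^- s * (l.+1%:R^-1 * d n).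
  move=> h; have [h1 h2] := freq_alias_le h.
  apply: le_trans (normc_deriv_coefB q2 h1 _) _.
    by apply: le_trans h2; rewrite -natrM ler1n muln_gt0 N_gt0.
  by rewrite -mulrA ler_wpM2l// (sqr_coef_le h).
have le1 : normc (alias (deriv_coef q) L m - (m%:~R * 'i) ^+ q * alias c L m) <=
    2 * N%:R ^- s * \sum_(l < L) l.+1%:R^-1 * e l.
  rewrite /alias mulrDr opprD addrACA {1}/deriv_coef subrr add0r mulr_sumr -sumrB.
  apply: le_trans (normc_sum _ _ _) _; rewrite mulr_sumr; apply: ler_sum => l _.
  rewrite mulrDr opprD addrACA; apply: le_trans (le_normcD _ _) _.
  by rewrite /e !mulrDr; apply: lerD; apply: term; [left|right].
have sum0 : 0 <= \sum_(l < L) l.+1%:R^-1 * e l.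
  by apply: sumr_ge0 => l _; rewrite mulr_ge0 ?invr_ge0// addr_ge0.
apply: (@le_trans _ _ ((2 * N%:R ^- s * \sum_(l < L) l.+1%:R^-1 * e l) ^+ 2)).
  by rewrite lerXn2r ?nnegrE ?normc_ge0 ?mulr_ge0.
rewrite exprMn exprMn (_ : 2 ^+ 2 = 4); last by ring.
rewrite (_ : 16 = 4 * 4); last by ring.
set Y := \sum_(l < L) (_ + _).
rewrite [leRHS](_ : _ = 4 * N%:R ^- s ^+ 2 * (4 * Y)); last by ring.
rewrite ler_wpM2l ?mulr_ge0 ?sqr_ge0// /Y.
apply: le_trans (sum_cauchy_schwarz _ _ _) _.
apply: (@le_trans _ _ (2 * \sum_(l < L) e l ^+ 2)).
  apply: ler_wpM2r; first by apply: sumr_ge0 => l _; exact: sqr_ge0.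
  by under eq_bigr do rewrite exprVn; exact: sum_invsqr_le.
rewrite (_ : 4 = 2 * 2); last by ring.
rewrite -mulrA ler_wpM2l// mulr_sumr; apply: ler_sum => l _.
rewrite /e -subr_ge0; move: (d _) (d _) => x y.
rewrite (_ : _ - _ = (x - y) ^+ 2); last by ring.
exact: sqr_ge0.
Qed.

Lemma alias_error_sum q L : (q <= 2)%N ->
  \sum_(k < 2 * N) normc (alias (deriv_coef q) L (freq N k) -
         ((freq N k)%:~R * 'i) ^+ q * alias c L (freq N k)) ^+ 2 <=
  16 * (N%:R ^- s) ^+ 2 * S0.
Proof.
move=> q2; apply: le_trans (ler_sum _ (fun k _ => alias_error_sqr L k q2)) _.
rewrite -mulr_sumr ler_wpM2l ?mulr_ge0 ?sqr_ge0//.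
(* The tails of all residue classes together are part of one window, which [decay] controls. *)
apply: le_trans (decay (N * (2 * L + 1))); rewrite ssum_tile.
by apply: ler_sum => k _; rewrite lerDr sqr_ge0.
Qed.

(** By 2ab <= a^2 + b^2 with a = |n|^(s+2) |c n| and b = 1/|n|, using |n|^3 <= |n|^(s+2). *)
Lemma sqr_weighted_sum_le K : ssum K (fun n => `|n%:~R| ^+ 2 * normc (c n)) <= (S0 + 6) / 2.
Proof.
rewrite ler_pdivlMr// mulr_suml.
apply: le_trans (lerD (decay K) (@ssum_invsqr_le R K)).
rewrite /ssum -big_split /=; apply: ler_sum => j _; set n := freq K j.
have [->|n0] := eqVneq n 0.
  by rewrite normr0 expr0n mul0r mul0r addr_ge0 ?sqr_ge0 ?invr_ge0 ?sqr_ge0.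
have n1 : (1 : R) <= `|n%:~R|.
  by rewrite -intr_norm -[1]/(1%:~R) ler_int -gtz0_ge1 normr_gt0.
set x : R := `|n%:~R| in n1 *; have -> : (n%:~R : R) ^- 2 = x^-1 ^+ 2.
  by rewrite /x exprVn real_normK ?num_real.
have x0 : x != 0 by rewrite gt_eqF ?(lt_le_trans ltr01).
have -> : x ^+ 2 * normc (c n) * 2 = 2 * (x ^+ 3 * normc (c n)) * x^-1 by field.
apply: (@le_trans _ _ (2 * (x ^+ s.+2 * normc (c n)) * x^-1)).
  rewrite ler_wpM2r ?invr_ge0 ?(le_trans ler01)// ler_wpM2l// ler_wpM2r ?normc_ge0//.
  by rewrite ler_weXn2l// ltnS ltnS.
move: (x ^+ s.+2 * normc (c n)) (x^-1) => a b; rewrite -subr_ge0.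
rewrite (_ : _ - _ = (a - b) ^+ 2); last by ring.
exact: sqr_ge0.
Qed.

Lemma weighted_sum_le K : ssum K (fun n => `|n%:~R| * normc (c n)) <= (S0 + 6) / 2.
Proof.
apply: le_trans (sqr_weighted_sum_le K); apply: ler_sum => j _.
rewrite ler_wpM2r ?normc_ge0//; set n := freq K j.
have [->|n0] := eqVneq n 0; first by rewrite normr0 expr0n.
rewrite -[X in X <= _]expr1 ler_weXn2l//.
by rewrite -intr_norm -[1]/(1%:~R) ler_int -gtz0_ge1 normr_gt0.
Qed.

Lemma normc_deriv_sum_le L (j : nat) :
  normc (trig_sum (fun k : 'I_(2 * N) => alias (deriv_coef 1) L (freq N k)) (node j)) <=
  (S0 + 6) / 2.
Proof.
rewrite -ssum_node; apply: le_trans (weighted_sum_le (N * (2 * L + 1))).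
apply: le_trans (normc_sum _ _ _) _; apply: ler_sum => k _.
by rewrite Normc.normcM normc_expi mulr1 Normc.normcM normc_freqX expr1.
Qed.

(** The derivative of the truncated interpolant obeys the same bound as that of the truncated
    series, since aliasing only lowers the modulus of a frequency. *)
Lemma normc_deriv_alias_le L (j : nat) :
  normc (trig_sum (fun k : 'I_(2 * N) => ((freq N k)%:~R * 'i) ^+ 1 *
     alias c L (freq N k)) (node j)) <= (S0 + 6) / 2.
Proof.
apply: le_trans (weighted_sum_le (N * (2 * L + 1))); rewrite ssum_tile.
apply: le_trans (normc_sum _ _ _) _; apply: ler_sum => k _.
rewrite Normc.normcM normc_expi mulr1 Normc.normcM normc_freqX expr1.
apply: le_trans (ler_wpM2l (normr_ge0 _) (le_normcD _ _)) _.
rewrite mulrDr lerD2l.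
apply: le_trans (ler_wpM2l (normr_ge0 _) (normc_sum _ _ _)) _.
rewrite mulr_sumr; apply: ler_sum => l _.
apply: le_trans (ler_wpM2l (normr_ge0 _) (le_normcD _ _)) _.
rewrite mulrDr; apply: lerD; rewrite ler_wpM2r ?normc_ge0//.
  by have [] := @freq_alias_le k l _ (or_introl erefl).
by have [] := @freq_alias_le k l _ (or_intror erefl).
Qed.

(** At the node j: the derivative of order q of the Fourier sum over a finite window, minus that of
    the interpolant of the same sum. *)
Definition alias_error q L (j : nat) : R[i] :=
  trig_sum (fun k : 'I_(2 * N) => alias (deriv_coef q) L (freq N k)) (node j) -
  trig_sum (fun k : 'I_(2 * N) => ((freq N k)%:~R * 'i) ^+ q *
     alias c L (freq N k)) (node j).

Lemma discrete_alias_error q L : (q <= 2)%N ->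
  \sum_(j < 2 * N) normc (alias_error q L j) ^+ 2 <=
  32 * N%:R * (N%:R ^- s) ^+ 2 * S0.
Proof.
move=> q2; pose g (k : 'I_(2 * N)) := alias (deriv_coef q) L (freq N k) -
  ((freq N k)%:~R * 'i) ^+ q * alias c L (freq N k).
rewrite (eq_bigr (fun j : 'I_(2 * N) => normc (trig_sum g (node j)) ^+ 2)).
  rewrite discrete_parseval//.
  apply: (@le_trans _ _ ((2 * N)%:R * (16 * (N%:R ^- s) ^+ 2 * S0))).
    by rewrite ler_wpM2l//; exact: alias_error_sum.
  by rewrite natrM le_eqVlt; apply/orP; left; apply/eqP; ring.
move=> j _; congr (normc _ ^+ 2); rewrite /alias_error /trig_sum -sumrB.
by apply: eq_bigr => k _; rewrite -mulrBl.
Qed.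

(** The residual at a node, with v replaced by its Fourier sum over a finite window. *)
Definition truncation_error (A B C : R) L (j : nat) : R[i] :=
  A%:C * alias_error 2 L j + B%:C * alias_error 1 L j +
  C%:C * (trig_sum (fun k : 'I_(2 * N) => alias (deriv_coef 1) L (freq N k)) (node j) ^+ 2 -
   trig_sum (fun k : 'I_(2 * N) => ((freq N k)%:~R * 'i) ^+ 1 *
     alias c L (freq N k)) (node j) ^+ 2).

Lemma sum_truncation_error (A B C : R) L :
  \sum_(j < 2 * N) normc (truncation_error A B C L j) ^+ 2 <=
  96 * N%:R * (N%:R ^- s) ^+ 2 * (A ^+ 2 + B ^+ 2 + C ^+ 2 * (S0 + 6) ^+ 2) * S0.
Proof.
pose E q := \sum_(j < 2 * N) normc (alias_error q L j) ^+ 2.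
have E1 : E 1%N <= 32 * N%:R * (N%:R ^- s) ^+ 2 * S0 by exact: discrete_alias_error.
have E2 : E 2 <= 32 * N%:R * (N%:R ^- s) ^+ 2 * S0 by exact: discrete_alias_error.
apply: (@le_trans _ _ (3 * (A ^+ 2 * E 2 + (B ^+ 2 + C ^+ 2 * (S0 + 6) ^+ 2) * E 1%N))).
  rewrite /E !mulr_sumr -big_split/= mulr_sumr; apply: ler_sum => j _.
  apply: le_trans (sqr_normcD3 _ _ _) _; rewrite ler_wpM2l// mulrDl addrA.
  rewrite !Normc.normcM !exprMn !normc_real !real_normK ?num_real//.
  rewrite lerD2l -mulrA ler_wpM2l ?sqr_ge0//.
  (* In a^2 - b^2 = (a - b)(a + b) the first factor is the aliasing error of order 1, and the second
     is at most S0 + 6. *)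
  rewrite subr_sqr Normc.normcM exprMn mulrC ler_wpM2r ?sqr_ge0//.
  have S6 : 0 <= (S0 + 6) / 2.
    by apply: le_trans (normc_deriv_sum_le L j); exact: normc_ge0.
  rewrite lerXn2r ?nnegrE ?normc_ge0//; first by lra.
  apply: le_trans (le_normcD _ _) _.
  apply: le_trans (lerD (normc_deriv_sum_le L j) (normc_deriv_alias_le L j)) _.
  lra.
rewrite [leRHS](_ : _ = 3 * (A ^+ 2 * (32 * N%:R * (N%:R ^- s) ^+ 2 * S0) +
  (B ^+ 2 + C ^+ 2 * (S0 + 6) ^+ 2) * (32 * N%:R * (N%:R ^- s) ^+ 2 * S0))); last by ring.
rewrite ler_wpM2l//; apply: lerD; rewrite ler_wpM2l ?sqr_ge0//.
by rewrite addr_ge0 ?sqr_ge0// -exprMn sqr_ge0.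
Qed.

End aliasing.

(** * Consistency *)

Section consistency.
Variables (R : realType) (N s : nat) (v : R -> R[i]) (S0 : R).
Hypotheses (N_gt0 : (0 < N)%N) (s_gt0 : (0 < s)%N).

Notation J := (`[0, 2 * pi]%classic : set R).
Notation node := (@node R N).
Notation c := (fcoef v).

Hypothesis L2v : L2 v.
Hypothesis decay : forall K,
  ssum K (fun n => (`|n%:~R| ^+ s.+2 * normc (c n)) ^+ 2) <= S0.
Hypothesis dv : forall x, x \in J -> derivable_in J v x.
Hypothesis ddv : forall x, x \in J -> derivable_in J (dx v) x.
Hypothesis v_per : v 0 = v (2 * pi).

Let window L := (N * (2 * L + 1))%N.

Let window_ge L : (L <= window L)%N.
Proof. by rewrite /window; nia. Qed.

Lemma fourier_deriv1_cvg y : J y ->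
  ccvg (fun K => ssum K (fun n => deriv_coef c 1 n * expi n y)) (dx v y).
Proof.
move=> Jy; have yJ := mem_set Jy.
have := termwise_deriv yJ (dv yJ) (weighted_sum_le s_gt0 decay).
rewrite (_ : (fun K => _) = (fun K => ssum K (fun n => n%:~R * 'i * c n * expi n y)))//.
apply => z Jz; apply: fourier_cvg => //; exact: mem_set.
Qed.

Lemma fourier_deriv2_cvg y : J y ->
  ccvg (fun K => ssum K (fun n => deriv_coef c 2 n * expi n y)) (dx (dx v) y).
Proof.
move=> Jy; have yJ := mem_set Jy.
have dc K : ssum K (fun n => `|n%:~R| * normc (deriv_coef c 1 n)) <= (S0 + 6) / 2.
  apply: le_trans (sqr_weighted_sum_le s_gt0 decay K); apply: ler_sum => i _.
  by rewrite Normc.normcM normc_freqX expr1 mulrA -expr2.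
(* Applied to [dx v], whose series converges by the case of order 1. *)
have := termwise_deriv yJ (ddv yJ) dc fourier_deriv1_cvg.
rewrite (_ : (fun K => ssum K (fun n => deriv_coef c 2 n * _)) =
  (fun K => ssum K (fun n => n%:~R * 'i * deriv_coef c 1 n * expi n y)))//.
apply/funext => K; apply: eq_bigr => k _.
by rewrite /deriv_coef expr2 expr1 -[_ * _ * c _]mulrA.
Qed.

(** The aliasing formula. Each aliased sum is the discrete coefficient of a finite Fourier sum, and
    that coefficient involves only the node values, which converge to those of v. *)
Lemma alias_cvg (k : 'I_(2 * N)) :
  ccvg (fun L => alias N c L (freq N k)) (dft N v (freq N k)).
Proof.
rewrite (_ : (fun L => _) = (fun L => (2 * N)%:R^-1 * \sum_(j < 2 * N)
    ssum (window L) (fun n => c n * expi n (node j)) * expi (- freq N k) (node j))).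
  apply: ccvgM; first exact: ccvg_cst.
  apply: ccvg_sum => j; apply: ccvgM; last exact: ccvg_cst.
  apply: (ccvg_subseq (z := fun K => ssum K (fun n => c n * expi n (node j)))) => //.
  by apply: fourier_cvg => //; exact: node_in.
apply/funext => L.
rewrite -(dft_trig_sum N_gt0 (fun k : 'I_(2 * N) => alias N c L (freq N k)) k) /dft.
by congr (_ * _); apply: eq_bigr => j _; rewrite ssum_node.
Qed.

Lemma interp_alias_cvg (q j : nat) :
  ccvg (fun L => trig_sum (fun k : 'I_(2 * N) => ((freq N k)%:~R * 'i) ^+ q *
     alias N c L (freq N k)) (node j))
   (trig_sum (fun k : 'I_(2 * N) => ((freq N k)%:~R * 'i) ^+ q *
     dft N v (freq N k)) (node j)).
Proof.
apply: ccvg_sum => k; apply: ccvgM; last exact: ccvg_cst.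
by apply: ccvgM; [exact: ccvg_cst|exact: alias_cvg].
Qed.

Lemma fourier_node_cvg q (f : R -> R[i]) (j : 'I_(2 * N)) :
  ccvg (fun K => ssum K (fun n => deriv_coef c q n * expi n (node j))) (f (node j)) ->
  ccvg (fun L => trig_sum (fun k : 'I_(2 * N) =>
     alias N (deriv_coef c q) L (freq N k)) (node j)) (f (node j)).
Proof.
move=> cf; rewrite (_ : (fun L => _) = (fun L => ssum (window L)
   (fun n => deriv_coef c q n * expi n (node j)))).
  exact: (ccvg_subseq window_ge cf).
by apply/funext => L; rewrite ssum_node.
Qed.

Lemma truncation_error_cvg (A B C : R) (j : 'I_(2 * N)) :
  ccvg (fun L => truncation_error N c A B C L j)
    (A%:C * (dx (dx v) (node j) - dx (dx (interp N v)) (node j)) +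
     B%:C * (dx v (node j) - dx (interp N v) (node j)) +
     C%:C * (dx v (node j) ^+ 2 - dx (interp N v) (node j) ^+ 2)).
Proof.
have Jj : J (node j) by apply/set_mem/node_in.
have h1 := fourier_node_cvg (fourier_deriv1_cvg Jj).
have h2 := fourier_node_cvg (fourier_deriv2_cvg Jj).
rewrite /interp dxx_trig_sum ?node_in// dx_trig_sum ?node_in//.
have g1 := interp_alias_cvg 1 j; have g2 := interp_alias_cvg 2 j.
have e2 : trig_sum (fun k : 'I_(2 * N) => (freq N k)%:~R * 'i *
    ((freq N k)%:~R * 'i * dft N v (freq N k))) (node j) =
    trig_sum (fun k : 'I_(2 * N) => ((freq N k)%:~R * 'i) ^+ 2 *
     dft N v (freq N k)) (node j).
  by apply: eq_bigr => k _; rewrite expr2 !mulrA.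
rewrite e2; apply: ccvgD.
  apply: ccvgD; (apply: ccvgM; first exact: ccvg_cst); exact: ccvgB.
apply: ccvgM; first exact: ccvg_cst.
by rewrite !expr2; apply: ccvgB; exact: ccvgM.
Qed.

Lemma spatial_consistency (A B C : R) (F : R -> R[i]) : S_ N F ->
  (forall j : 'I_(2 * N), F (node j) =
     A%:C * (dx (dx v) (node j) - dx (dx (interp N v)) (node j)) +
     B%:C * (dx v (node j) - dx (interp N v) (node j)) +
     C%:C * (dx v (node j) ^+ 2 - dx (interp N v) (node j) ^+ 2)) ->
  (L2norm F <= (Num.sqrt (96 * pi * (A ^+ 2 + B ^+ 2 + C ^+ 2 * (S0 + 6) ^+ 2) * S0) *
     N%:R ^- s)%:E)%E.
Proof.
move=> SF FE; rewrite (L2norm_S_ N_gt0 SF) lee_fin.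
have N0 : (0 : R) < N%:R by rewrite ltr0n.
have Ns : 0 <= N%:R ^- s :> R by rewrite invr_ge0 exprn_ge0.
set X := _ * S0.
have sumF : \sum_(j < 2 * N) normc (F (node j)) ^+ 2 <=
    96 * N%:R * (N%:R ^- s) ^+ 2 * (A ^+ 2 + B ^+ 2 + C ^+ 2 * (S0 + 6) ^+ 2) * S0.
  (* The finite-window bound does not depend on L, so it survives the limit. *)
  have cv : (fun L => \sum_(j < 2 * N) normc (truncation_error N c A B C L j) ^+ 2) @ \oo -->
      \sum_(j < 2 * N) normc (F (node j)) ^+ 2.
    apply: cvg_big => [|j _]; first exact: add_continuous.
    by rewrite FE; apply: ccvg_sqr_normc; exact: truncation_error_cvg.
  apply: (cvgr_to_le cv); apply: nearW => L.
  exact: sum_truncation_error.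
rewrite -[X in _ <= _ * X](ger0_norm Ns) -sqrtr_sqr -sqrtrM.
  rewrite ler_wsqrtr//.
  apply: le_trans (ler_wpM2l (divr_ge0 (pi_ge0 R) (ltW N0)) sumF) _.
  by rewrite le_eqVlt /X; apply/orP; left; apply/eqP; field; rewrite ?gt_eqF ?exprn_gt0.
have S00 : 0 <= S0 by apply: le_trans (decay 0); rewrite ssum0.
rewrite mulr_ge0// mulr_ge0 ?mulr_ge0 ?pi_ge0//.
by rewrite !addr_ge0 ?sqr_ge0// -exprMn sqr_ge0.
Qed.

End consistency.

Theorem proposition4p2 (R : realType) (alpha sigma xmin xmax A B C : R) (s : nat)
    (sigma_gt0 : 0 < sigma) (lt_xmin_xmax : xmin < xmax)
    (defA : A = diffusion sigma xmin xmax)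
    (defB : B = advection alpha sigma xmin xmax)
    (defC : C = diffusion sigma xmin xmax)
    (s_ge1 : (1 <= s)%N) :
  exists M : R -> R,
    forall (T : R) (u0 : R -> R[i]) (u : R -> R -> R[i]),
      0 < T ->
      is_solution A B C T u0 u ->
      Hp s.+2 u0 ->
      (forall tau, tau \in `[0, T] -> Hp s.+2 (u tau)) ->
      (forall tau, tau \in `[0, T] -> Hp s (dtau T u tau)) ->
      (regularity_max s T u < +oo)%E ->
      forall (N : nat) (F : R -> R -> R[i]),
        (1 <= N)%N ->
        is_consistency_error A B C T N u F ->
        (ereal_sup [set L2norm (F tau) | tau in `[0%R, T]]
          <= (M (fine (regularity_max s T u)) * N%:R ^- s)%R%:E)%E.
Proof.
(* By Bessel, 2 pi times the weighted sum of squares is at most r^2. *)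
pose S0 (r : R) := r ^+ 2 / (2 * pi).
exists (fun r => Num.sqrt (96 * pi *
  (A ^+ 2 + B ^+ 2 + C ^+ 2 * (S0 r + 6) ^+ 2) * S0 r)).
move=> T u0 u T0 sol _ Hu _ regfin N F N1 FN.
apply: ge_ereal_sup => _ [tau /= tauT <-].
have Hv := Hu tau tauT; have [L2v _] := Hv.
have [SF Fnode] := FN tau tauT.
set reg := regularity_max s T u in regfin *.
have [L2d _] := pderivP Hv (leqnn _).
have normle : (L2norm (pderiv s.+2 (u tau)) <= reg)%E.
  apply: (@le_trans _ _ (maxe (L2norm (pderiv s.+1 (u tau)))
    (maxe (L2norm (pderiv s.+2 (u tau))) (L2norm (pderiv s (dtau T u tau)))))).
    by rewrite !le_max lexx /= orbT.
  by apply: ereal_sup_ubound; exists tau.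
have reg_num : reg = (fine reg)%:E.
  rewrite fineK// ge0_fin_numE//; apply: le_trans normle.
  by rewrite /L2norm Lnorm_ge0.
have sq : sqnorm (pderiv s.+2 (u tau)) <= fine reg ^+ 2.
  move: normle; rewrite L2norm_sqnorm// {1}reg_num lee_fin => h.
  rewrite -[leLHS]sqr_sqrtr ?sqnorm_ge0// lerXn2r ?nnegrE ?sqrtr_ge0//.
  exact: le_trans h.
apply: (@spatial_consistency _ N s (u tau)) => //.
- move=> K; rewrite /S0 ler_pdivlMr ?mulr_gt0 ?pi_gt0// mulrC.
  by apply: le_trans sq; exact: fcoef_decay.
- by move=> x /set_mem xJ; exact: (sol_dx sol).
- by move=> x /set_mem xJ; exact: (sol_dxx sol).
- exact: (sol_per sol).
move=> j; rewrite Fnode /residual.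
have jJ : node R N j \in `[0, 2 * pi] by exact/set_mem/node_in.
(* At a node the interpolant and u are the same function of time. *)
have -> : dtau T (fun t => interp N (u t)) tau (node R N j) = dtau T u tau (node R N j).
  by rewrite /dtau; congr deriv_in; apply/funext => t; rewrite interp_node.
by rewrite (sol_pde sol)//; ring.
Qed.
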